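(* Let $G$ be a self-small abelian group of torsion-free rank at most $4$. If $G$ has the cancellation property, then there is a direct decomposition $G=F\oplus H$ such that $F$ is a free group and the Walk-endomorphism ring $\mathrm{End}_{\mathrm{W}}(H)=\mathrm{End}(H)/\mathrm{Hom}(H,T(H))$ has the unit lifting property.
   Context: All groups are abelian. $T(H)$ is the torsion part of $H$. The torsion-free rank of $G$ is $r_0(G)=\dim_{\mathbb{Q}}(\mathbb{Q}\otimes G)$. A group $G$ is self-small if for every set $I$ the canonical homomorphism $\mathrm{Hom}(G,G)^{(I)}\to \mathrm{Hom}(G,G^{(I)})$ is an isomorphism. A group $G$ has the cancellation property if whenever $A,B$ are (abelian) groups with $G\oplus A\cong G\oplus B$, it follows that $A\cong B$. The Walk-endomorphism ring of $H$ is the quotient ring $\mathrm{End}_{\mathrm{W}}(H)=\mathrm{End}(H)/\mathrm{Hom}(H,T(H))$, where $\mathrm{Hom}(H,T(H))$ is viewed as the ideal of endomorphisms with image in $T(H)$. A ring $R$ has the unit lifting property if for every positive integer $n$ every unit of $R/nR$ can be lifted to a unit of $R$. The zero group is free. *)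

(* Defs.v *)
(* Abelian groups are [zmodType]s. Rings are [pzRingType]s, since the rings
   End(H), End_W(H) and R/nR may be trivial. *)
From HB Require Import structures.
From mathcomp Require Export all_boot all_order all_algebra.
From mathcomp Require Export boolp classical_sets functions cardinality fsbigop.
From mathcomp Require Import finmap.

Set Implicit Arguments.
Unset Strict Implicit.
Unset Printing Implicit Defensive.

Import GRing.Theory.
Local Open Scope ring_scope.
Local Open Scope quotient_scope.

Definition zmod_iso (A B : zmodType) : Prop :=
  exists f : {additive A -> B}, bijective f.

Definition hom (A B : zmodType) : Type := {additive A -> B}.
Identity Coercion additive_of_hom : hom >-> GRing.Additive.type.

Lemma homP (A B : zmodType) (f g : hom A B) : f =1 g -> f = g.
Proof.
case: f g => [f [[fP]]] [g [[gP]]] /= /funext fg.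
by case: _ / fg in gP *; rewrite (Prop_irrelevance fP gP).
Qed.

HB.instance Definition _ (A B : zmodType) := gen_eqMixin (hom A B).
HB.instance Definition _ (A B : zmodType) := gen_choiceMixin (hom A B).

Section HomZmodule.
Variables A B : zmodType.
Implicit Types f g h : hom A B.

Definition hom0 : hom A B := (\0 : A -> B)%R.
Definition homD f g : hom A B := (f \+ g)%R.
Definition homN f : hom A B := (\- f)%R.

Fact homDA : associative homD.
Proof. by move=> f g h; apply: homP => x /=; rewrite addrA. Qed.
Fact homDC : commutative homD.
Proof. by move=> f g; apply: homP => x /=; rewrite addrC. Qed.
Fact hom0D : left_id hom0 homD.
Proof. by move=> f; apply: homP => x /=; rewrite add0r. Qed.
Fact homND : left_inverse hom0 homN homD.
Proof. by move=> f; apply: homP => x /=; rewrite addNr. Qed.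

HB.instance Definition _ :=
  GRing.isZmodule.Build (hom A B) homDA homDC hom0D homND.

Lemma hom0E x : (0 : hom A B) x = 0. Proof. by []. Qed.
Lemma homDE f g x : (f + g) x = f x + g x. Proof. by []. Qed.
Lemma homNE f x : (- f) x = - f x. Proof. by []. Qed.

End HomZmodule.

Definition endo (H : zmodType) : Type := hom H H.
Identity Coercion hom_of_endo : endo >-> hom.
HB.instance Definition _ (H : zmodType) := GRing.Zmodule.on (endo H).

Section EndoRing.
Variable H : zmodType.
Implicit Types f g h : endo H.

Definition endo1 : endo H := (idfun : H -> H).
Definition endoM f g : endo H := (f \o g : H -> H).

Fact endoMA : associative endoM.
Proof. by move=> f g h; apply: homP. Qed.
Fact endo1M : left_id endo1 endoM.
Proof. by move=> f; apply: homP. Qed.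
Fact endoM1 : right_id endo1 endoM.
Proof. by move=> f; apply: homP. Qed.
Fact endoMDl : left_distributive endoM +%R.
Proof. by move=> f g h; apply: homP. Qed.
Fact endoMDr : right_distributive endoM +%R.
Proof. by move=> f g h; apply: homP => x; apply: raddfD. Qed.

HB.instance Definition _ :=
  GRing.Zmodule_isPzRing.Build (endo H) endoMA endo1M endoM1 endoMDl endoMDr.

Lemma endo1E x : (1 : endo H) x = x. Proof. by []. Qed.
Lemma endoME f g x : (f * g) x = f (g x). Proof. by []. Qed.

End EndoRing.

Section FiniteSupport.
Variables (I : Type) (G : zmodType).

Definition finite_supp : {pred I -> G} :=
  fun f => `[< finite_set [set i | f i != 0] >].

Lemma finite_suppP (f : I -> G) :
  reflect (finite_set [set i | f i != 0]) (f \in finite_supp).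
Proof. exact: asboolP. Qed.

Fact finite_supp_zmod_closed : zmod_closed finite_supp.
Proof.
split=> [|f g /finite_suppP finf /finite_suppP fing]; apply/finite_suppP.
  by apply: (sub_finite_set _ (finite_set0 I)) => i /=; rewrite eqxx.
apply: (@sub_finite_set _ _ ([set i | f i != 0] `|` [set i | g i != 0])%classic).
  move=> i /= fgi; have [fi0|] := eqVneq (f i) 0; [right | by left].
  by apply: contra fgi => /eqP gi0; rewrite /= !fctE fi0 gi0 subrr.
by rewrite finite_setU.
Qed.
HB.instance Definition _ :=
  GRing.isZmodClosed.Build (I -> G) finite_supp finite_supp_zmod_closed.

(* The direct sum G^(I) of copies of G indexed by I. *)
Record dsum := Dsum { dsum_fun :> I -> G; _ : dsum_fun \in finite_supp }.

HB.instance Definition _ := [isSub for dsum_fun].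
HB.instance Definition _ := [Choice of dsum by <:].
HB.instance Definition _ := [SubChoice_isSubZmodule of dsum by <:].

Lemma dsumP (f g : dsum) : f =1 g -> f = g.
Proof. by move=> fg; apply: val_inj; apply: funext. Qed.

Lemma dsum_finite (f : dsum) : finite_set [set i | f i != 0].
Proof. exact/finite_suppP/(valP f). Qed.

Lemma dsum0E i : (0 : dsum) i = 0. Proof. by []. Qed.
Lemma dsumDE (f g : dsum) i : (f + g) i = f i + g i. Proof. by []. Qed.
Lemma dsumNE (f : dsum) i : (- f) i = - f i. Proof. by []. Qed.

End FiniteSupport.

(* I may be empty: the zero group is free. *)
Definition free_group (F : zmodType) : Prop :=
  exists I : Type, zmod_iso F (dsum I int).

Section Canonical.
Variables (I : Type) (A B : zmodType).

Fact dsum_eval_subproof (f : dsum I (hom A B)) (x : A) :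
  (fun i => f i x) \in @finite_supp I B.
Proof.
apply/finite_suppP; apply: sub_finite_set (dsum_finite f) => i /=.
by apply: contra => /eqP ->.
Qed.
Definition dsum_eval f x : dsum I B := Dsum (dsum_eval_subproof f x).

Fact dsum_eval_is_zmod_morphism f : zmod_morphism (dsum_eval f).
Proof. by move=> x y; apply: dsumP => i; apply: raddfB. Qed.
HB.instance Definition _ f := GRing.isZmodMorphism.Build A (dsum I B)
  (dsum_eval f) (dsum_eval_is_zmod_morphism f).

(* The canonical map Hom(A, B)^(I) -> Hom(A, B^(I)). *)
Definition hom_dsum (f : dsum I (hom A B)) : hom A (dsum I B) := dsum_eval f.

Fact hom_dsum_is_zmod_morphism : zmod_morphism hom_dsum.
Proof. by move=> f g; apply: homP => x; apply: dsumP. Qed.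
HB.instance Definition _ := GRing.isZmodMorphism.Build
  (dsum I (hom A B)) (hom A (dsum I B)) hom_dsum hom_dsum_is_zmod_morphism.

End Canonical.

Definition self_small (G : zmodType) : Prop :=
  forall I : Type, bijective (@hom_dsum I G G).

Definition cancellation_property (G : zmodType) : Prop :=
  forall A B : zmodType,
    zmod_iso (G * A)%type (G * B)%type -> zmod_iso A B.

Definition torsion_part (H : zmodType) : {pred H} :=
  fun x => `[< exists2 n : nat, (0 < n)%N & x *+ n = 0 >].
Arguments torsion_part : clear implicits.

Lemma torsionP (H : zmodType) (x : H) :
  reflect (exists2 n : nat, (0 < n)%N & x *+ n = 0) (x \in torsion_part H).
Proof. exact: asboolP. Qed.

Fact torsion_zmod_closed (H : zmodType) : zmod_closed (torsion_part H).
Proof.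
split=> [|x y /torsionP[m m0 xm] /torsionP[n n0 yn]]; apply/torsionP.
  by exists 1%N.
exists (m * n)%N; first by rewrite muln_gt0 m0.
by rewrite mulrnBl mulrnA xm mul0rn mulnC mulrnA yn mul0rn subrr.
Qed.
HB.instance Definition _ (H : zmodType) :=
  GRing.isZmodClosed.Build H (torsion_part H) (torsion_zmod_closed H).

(* [ring_quotient] only covers proper ideals of nontrivial commutative rings. *)
HB.mixin Record isTwoSidedMul (R : pzRingType) (S : R -> bool) := {
  ideal_mull : forall a u, u \in S -> a * u \in S;
  ideal_mulr : forall a u, u \in S -> u * a \in S
}.
#[short(type="twoSidedIdeal")]
HB.structure Definition TwoSidedIdeal (R : pzRingType) :=
  {S of GRing.ZmodClosed R S & isTwoSidedMul R S}.

Definition ring_quot (R : pzRingType) (I : twoSidedIdeal R) : Type :=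
  @Quotient.quot R I.

Section RingQuot.
Variables (R : pzRingType) (I : twoSidedIdeal R).
Local Notation Q := (ring_quot I).

HB.instance Definition _ := GRing.Zmodule.on Q.
HB.instance Definition _ : EqQuotient R (@Quotient.equiv R I) Q :=
  EqQuotient.on Q.

Definition ring_proj (x : R) : Q := \pi_Q x.

Lemma ring_proj_eq x y : (ring_proj x = ring_proj y) <-> (x - y \in I).
Proof.
rewrite -[x - y \in I]/(Quotient.equiv I x y).
by split=> [/eqP|xy]; [rewrite piE | apply/eqP; rewrite piE].
Qed.

Lemma ring_projK (q : Q) : ring_proj (repr q) = q.
Proof. exact: reprK. Qed.

Fact ring_proj_is_zmod_morphism : zmod_morphism ring_proj.
Proof. exact: (@pi_is_zmod_morphism R _ _ (@Quotient.quot R I)). Qed.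

HB.instance Definition _ :=
  GRing.isZmodMorphism.Build R Q ring_proj ring_proj_is_zmod_morphism.

Definition ring_quot1 : Q := ring_proj 1.
Definition ring_quotM (p q : Q) : Q := ring_proj (repr p * repr q).

Fact ring_projM : {morph ring_proj : x y / x * y >-> ring_quotM x y}.
Proof.
move=> x y; apply/ring_proj_eq.
set x' := repr _; set y' := repr _.
have Ix : x - x' \in I by apply/ring_proj_eq; rewrite ring_projK.
have Iy : y - y' \in I by apply/ring_proj_eq; rewrite ring_projK.
have -> : x * y - x' * y' = (x - x') * y + x' * (y - y').
  by rewrite mulrBl mulrBr addrA subrK.
by apply: rpredD; [apply: ideal_mulr | apply: ideal_mull].
Qed.


Fact ring_quotMA : associative ring_quotM.
Proof.
move=> p q r; rewrite -(ring_projK p) -(ring_projK q) -(ring_projK r).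
by rewrite -!ring_projM mulrA.
Qed.
Fact ring_quot1M : left_id ring_quot1 ring_quotM.
Proof. by move=> p; rewrite -(ring_projK p) -ring_projM mul1r. Qed.
Fact ring_quotM1 : right_id ring_quot1 ring_quotM.
Proof. by move=> p; rewrite -(ring_projK p) -ring_projM mulr1. Qed.
Fact ring_quotMDl : left_distributive ring_quotM +%R.
Proof.
move=> p q r; rewrite -(ring_projK p) -(ring_projK q) -(ring_projK r).
by rewrite -raddfD -!ring_projM mulrDl raddfD.
Qed.
Fact ring_quotMDr : right_distributive ring_quotM +%R.
Proof.
move=> p q r; rewrite -(ring_projK p) -(ring_projK q) -(ring_projK r).
by rewrite -raddfD -!ring_projM mulrDr raddfD.
Qed.

HB.instance Definition _ := GRing.Zmodule_isPzRing.Build Q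
  ring_quotMA ring_quot1M ring_quotM1 ring_quotMDl ring_quotMDr.

Fact ring_proj_is_monoid_morphism : monoid_morphism ring_proj.
Proof. by split=> //; apply: ring_projM. Qed.
HB.instance Definition _ :=
  GRing.isMonoidMorphism.Build R Q ring_proj ring_proj_is_monoid_morphism.

End RingQuot.

(* [GRing.unit] needs a [unitRingType]: nontrivial, with decidable units. *)
Definition is_unit (R : pzRingType) (u : R) : Prop :=
  exists v : R, v * u = 1 /\ u * v = 1.

Section Multiples.
Variables (R : pzRingType) (n : nat).

Definition multiples : {pred R} := fun x => `[< exists r : R, x = r *+ n >].

Lemma multiplesP (x : R) :
  reflect (exists r : R, x = r *+ n) (x \in multiples).
Proof. exact: asboolP. Qed.

Fact multiples_zmod_closed : zmod_closed multiples.
Proof.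
split=> [|_ _ /multiplesP[r ->] /multiplesP[s ->]]; apply/multiplesP.
  by exists 0; rewrite mul0rn.
by exists (r - s); rewrite mulrnBl.
Qed.
HB.instance Definition _ :=
  GRing.isZmodClosed.Build R multiples multiples_zmod_closed.

Fact multiples_mull a u : u \in multiples -> a * u \in multiples.
Proof.
by move=> /multiplesP[r ->]; apply/multiplesP; exists (a * r); rewrite mulrnAr.
Qed.
Fact multiples_mulr a u : u \in multiples -> u * a \in multiples.
Proof.
by move=> /multiplesP[r ->]; apply/multiplesP; exists (r * a); rewrite mulrnAl.
Qed.
HB.instance Definition _ :=
  isTwoSidedMul.Build R multiples multiples_mull multiples_mulr.

End Multiples.
Arguments multiples : clear implicits.

Definition unit_lifting_property (R : pzRingType) : Prop :=
  forall n : nat, (0 < n)%N ->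
  forall u : ring_quot (multiples R n), is_unit u ->
  exists2 v : R, is_unit v & ring_proj (multiples R n) v = u.

Section WalkEndomorphisms.
Variable H : zmodType.

Definition torsion_hom : {pred endo H} :=
  fun f => `[< forall x : H, f x \in torsion_part H >].

Lemma torsion_homP (f : endo H) :
  reflect (forall x : H, f x \in torsion_part H) (f \in torsion_hom).
Proof. exact: asboolP. Qed.

Fact torsion_hom_zmod_closed : zmod_closed torsion_hom.
Proof.
split=> [|f g /torsion_homP fT /torsion_homP gT]; apply/torsion_homP => x.
  exact: rpred0.
by apply: rpredB; [apply: fT | apply: gT].
Qed.
HB.instance Definition _ :=
  GRing.isZmodClosed.Build (endo H) torsion_hom torsion_hom_zmod_closed.

Fact torsion_hom_mull (f g : endo H) : g \in torsion_hom -> f * g \in torsion_hom.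
Proof.
move=> /torsion_homP gT; apply/torsion_homP => x; apply/torsionP.
have /torsionP[n n0 gxn] := gT x; exists n => //.
by rewrite endoME -raddfMn gxn raddf0.
Qed.
Fact torsion_hom_mulr (f g : endo H) : g \in torsion_hom -> g * f \in torsion_hom.
Proof. by move=> /torsion_homP gT; apply/torsion_homP => x; apply: gT. Qed.
HB.instance Definition _ :=
  isTwoSidedMul.Build (endo H) torsion_hom torsion_hom_mull torsion_hom_mulr.

End WalkEndomorphisms.
Arguments torsion_hom : clear implicits.

Definition walk_endo (H : zmodType) : pzRingType := ring_quot (torsion_hom H).

Section Span.
Variables (V : zmodType) (S : set V).

Definition zspan : {pred V} :=
  fun x => `[< forall K : {pred V},
    zmod_closed K -> (forall y, S y -> y \in K) -> x \in K >].

Lemma zspanP (x : V) :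
  reflect (forall K : {pred V},
             zmod_closed K -> (forall y, S y -> y \in K) -> x \in K)
          (x \in zspan).
Proof. exact: asboolP. Qed.

Fact zspan_zmod_closed : zmod_closed zspan.
Proof.
split=> [|x y /zspanP xS /zspanP yS]; apply/zspanP => K KP SK.
  by case: KP.
by case: (KP) => _; apply; [apply: xS | apply: yS].
Qed.
HB.instance Definition _ := GRing.isZmodClosed.Build V zspan zspan_zmod_closed.

Lemma mem_zspan x : S x -> x \in zspan.
Proof. by move=> Sx; apply/zspanP => K _; apply. Qed.

End Span.

Section Generators.
Variable I : Type.

Fact dsum_gen_subproof (i : I) :
  (fun j => (`[< j = i >] : nat)%:Z) \in @finite_supp I int.
Proof.
apply/finite_suppP; apply: sub_finite_set (finite_set1 i) => j /=.
by case: asboolP.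
Qed.
Definition dsum_gen i : dsum I int := Dsum (dsum_gen_subproof i).

End Generators.

Section Lift.
Variables (I : choiceType) (M : zmodType).

(* The homomorphism Z^(I) -> M with values phi on the canonical basis. *)
Definition dsum_lift (phi : I -> M) (f : dsum I int) : M :=
  \sum_(i \in [set: I]) phi i *~ f i.

Lemma dsum_lift_fset (phi : I -> M) (f : dsum I int) (A : {fset I}) :
  (forall i, i \notin A -> f i = 0) ->
  dsum_lift phi f = \sum_(i <- A) phi i *~ f i.
Proof. by move=> fA; apply: fsbigTE => i /fA ->; rewrite mulr0z. Qed.

Fact dsum_lift_is_zmod_morphism (phi : I -> M) : zmod_morphism (dsum_lift phi).
Proof.
move=> f g; pose A := fset_set [set i | f i != 0].
pose B := fset_set [set i | g i != 0].
have fA i : i \notin (A `|` B)%fset -> f i = 0.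
  rewrite in_fsetU negb_or => /andP[+ _].
  rewrite in_fset_set; last exact: dsum_finite.
  by move=> /negP iA; apply/eqP/negPn/negP => /mem_set.
have gB i : i \notin (A `|` B)%fset -> g i = 0.
  rewrite in_fsetU negb_or => /andP[_].
  rewrite in_fset_set; last exact: dsum_finite.
  by move=> /negP iA; apply/eqP/negPn/negP => /mem_set.
rewrite !(@dsum_lift_fset phi _ (A `|` B)%fset) //.
  by rewrite -sumrB; apply: eq_bigr => i _; rewrite -mulrzBr.
by move=> i iAB; rewrite dsumDE dsumNE fA ?gB // subrr.
Qed.
HB.instance Definition _ phi := GRing.isZmodMorphism.Build (dsum I int) M
  (dsum_lift phi) (dsum_lift_is_zmod_morphism phi).

Lemma dsum_lift_gen phi i : dsum_lift phi (dsum_gen i) = phi i.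
Proof.
rewrite (@dsum_lift_fset phi _ [fset i]%fset) => [|j].
  by rewrite big_seq_fset1 /= asboolT.
by rewrite in_fset1 /= => /eqP ji; rewrite asboolF.
Qed.

End Lift.

Lemma dsum_genE (I : choiceType) (f : dsum I int) :
  f = dsum_lift (@dsum_gen I) f.
Proof.
pose A := fset_set [set i | f i != 0].
have fA i : i \notin A -> f i = 0.
  rewrite in_fset_set; last exact: dsum_finite.
  by move=> /negP iA; apply/eqP/negPn/negP => /mem_set.
rewrite (@dsum_lift_fset _ _ _ _ A) //; apply: dsumP => j.
have ev (K : seq I) :
  (\sum_(i <- K) dsum_gen i *~ f i) j = \sum_(i <- K) dsum_gen i j *~ f i.
  elim: K => [|i K IHK]; first by rewrite !big_nil.
  rewrite !big_cons dsumDE IHK; congr (_ + _).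
  have evD : zmod_morphism (fun h : dsum I int => h j) by [].
  pose e : {additive dsum I int -> int} :=
    HB.pack (fun h : dsum I int => h j)
      (GRing.isZmodMorphism.Build _ _ _ evD).
  exact: (raddfMz e).
rewrite ev; have [jA|jA] := boolP (j \in A).
  rewrite (big_fsetD1 j) //= asboolT // big_seq big1 ?addr0 ?intz //.
  by move=> i; rewrite in_fsetD1 => /andP[/eqP ij _]; rewrite asboolF ?mul0rz // => /esym.
rewrite fA // big_seq big1 // => i iA; rewrite /= asboolF ?mul0rz // => ji.
by rewrite ji iA in jA.
Qed.

Lemma dsum_ext (I : choiceType) (M : zmodType) (p q : {additive dsum I int -> M}) :
  (forall i, p (dsum_gen i) = q (dsum_gen i)) -> p =1 q.
Proof.
move=> pq f; rewrite (dsum_genE f) /dsum_lift !raddf_sum.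
by apply: eq_bigr => i _; rewrite !raddfMz pq.
Qed.

Section Tensor.
Variables A B : zmodType.

Local Notation Z_AB := (dsum (A * B)%type int).

Definition tensor_rel : set Z_AB := [set z |
  (exists a a' b,
     z = dsum_gen (a + a', b) - dsum_gen (a, b) - dsum_gen (a', b)) \/
  (exists a b b',
     z = dsum_gen (a, b + b') - dsum_gen (a, b) - dsum_gen (a, b'))].

Definition tensor : Type := @Quotient.quot Z_AB (zspan tensor_rel).
HB.instance Definition _ := GRing.Zmodule.on tensor.
HB.instance Definition _ : EqQuotient _ (@Quotient.equiv _ (zspan tensor_rel)) tensor :=
  EqQuotient.on tensor.

Definition tensor_proj (z : Z_AB) : tensor := \pi_tensor z.

Lemma tensor_proj_eq x y :
  (tensor_proj x = tensor_proj y) <-> (x - y \in zspan tensor_rel).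
Proof.
rewrite -[x - y \in _]/(Quotient.equiv (zspan tensor_rel) x y).
by split=> [/eqP|xy]; [rewrite piE | apply/eqP; rewrite piE].
Qed.

Lemma tensor_projK (t : tensor) : tensor_proj (repr t) = t.
Proof. exact: reprK. Qed.

Fact tensor_proj_is_zmod_morphism : zmod_morphism tensor_proj.
Proof. exact: (@pi_is_zmod_morphism _ _ _ (@Quotient.quot _ (zspan tensor_rel))). Qed.
HB.instance Definition _ :=
  GRing.isZmodMorphism.Build Z_AB tensor tensor_proj tensor_proj_is_zmod_morphism.

Definition tens (a : A) (b : B) : tensor := tensor_proj (dsum_gen (a, b)).

Lemma tensDl a a' b : tens (a + a') b = tens a b + tens a' b.
Proof.
rewrite /tens -raddfD; apply/tensor_proj_eq; rewrite opprD addrA.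
by apply: mem_zspan; left; exists a, a', b.
Qed.

Lemma tensDr a b b' : tens a (b + b') = tens a b + tens a b'.
Proof.
rewrite /tens -raddfD; apply/tensor_proj_eq; rewrite opprD addrA.
by apply: mem_zspan; right; exists a, b, b'.
Qed.

Lemma tensor_ext (M : zmodType) (p q : {additive tensor -> M}) :
  (forall a b, p (tens a b) = q (tens a b)) -> p =1 q.
Proof.
move=> pq t; rewrite -(tensor_projK t).
by apply: (@dsum_ext _ _ (p \o tensor_proj) (q \o tensor_proj)) => -[a b]; apply: pq.
Qed.

Section Universal.
Variables (M : zmodType) (phi : A -> B -> M).

Definition biadditive :=
  (forall b, {morph phi^~ b : a a' / a + a'}) /\
  (forall a, {morph phi a : b b' / b + b'}).

Definition tensor_lift (t : tensor) : M :=
  dsum_lift (fun p => phi p.1 p.2) (repr t).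

Hypothesis phiD : biadditive.

Lemma tensor_lift_proj z :
  tensor_lift (tensor_proj z) = dsum_lift (fun p => phi p.1 p.2) z.
Proof.
apply/eqP; rewrite -subr_eq0 -raddfB.
have : repr (tensor_proj z) - z \in zspan tensor_rel.
  by apply/tensor_proj_eq; rewrite tensor_projK.
move=> /zspanP /(_ (fun z => dsum_lift (fun p => phi p.1 p.2) z == 0)); apply.
  split=> [|x y /eqP x0 /eqP y0]; first by rewrite unfold_in raddf0.
  by rewrite unfold_in raddfB /= x0 y0 subrr.
move=> _ [[a [a' [b ->]]]|[a [b [b' ->]]]];
  rewrite unfold_in !raddfB /= !dsum_lift_gen /=.
  by rewrite phiD.1 addrAC addrK subrr.
by rewrite phiD.2 addrAC addrK subrr.
Qed.

Lemma tensor_lift_tens a b : tensor_lift (tens a b) = phi a b.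
Proof. by rewrite tensor_lift_proj dsum_lift_gen. Qed.

Lemma tensor_lift_is_zmod_morphism : zmod_morphism tensor_lift.
Proof.
move=> s t; rewrite -(tensor_projK s) -(tensor_projK t) -raddfB.
by rewrite !tensor_lift_proj raddfB.
Qed.

End Universal.
End Tensor.

Section RationalTensor.
Variable G : zmodType.
Local Notation QG := (tensor rat G).

Fact ratscale_biadditive (c : rat) : biadditive (fun q (g : G) => tens (c * q) g).
Proof.
by split=> [g q q'|q g g'] /=; [rewrite mulrDr tensDl | rewrite tensDr].
Qed.

(* c * (q (x) g) = (c q) (x) g *)
Definition ratscale (c : rat) : QG -> QG :=
  tensor_lift (fun q (g : G) => tens (c * q) g).

HB.instance Definition _ c := GRing.isZmodMorphism.Build QG QG (ratscale c)
  (tensor_lift_is_zmod_morphism (ratscale_biadditive c)).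

Lemma ratscale_tens c q g : ratscale c (tens q g) = tens (c * q) g.
Proof. exact: (tensor_lift_tens (ratscale_biadditive c)). Qed.

Fact ratscaleA c d t : ratscale c (ratscale d t) = ratscale (c * d) t.
Proof.
apply: (@tensor_ext _ _ _ (ratscale c \o ratscale d) (ratscale (c * d))) => q g.
by rewrite /= !ratscale_tens mulrA.
Qed.
Fact ratscale1 : left_id 1 ratscale.
Proof.
apply: (@tensor_ext _ _ _ (ratscale 1) idfun) => q g.
by rewrite /= ratscale_tens mul1r.
Qed.
Fact ratscaleDr : right_distributive ratscale +%R.
Proof. by move=> c s t; apply: raddfD. Qed.
Fact ratscaleDl t : {morph ratscale^~ t : c d / c + d}.
Proof.
move=> c d.
apply: (@tensor_ext _ _ _ (ratscale (c + d)) (ratscale c \+ ratscale d)) => q g.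
by rewrite /= !ratscale_tens mulrDl tensDl.
Qed.

HB.instance Definition _ := GRing.Zmodule_isLmodule.Build rat QG
  ratscaleA ratscale1 ratscaleDr ratscaleDl.

Lemma scale_tens (c q : rat) (g : G) : c *: tens q g = tens (c * q) g.
Proof. exact: ratscale_tens. Qed.

End RationalTensor.

Definition is_basis (K : fieldType) (V : lmodType K) n (b : 'I_n -> V) : Prop :=
  (forall c : 'I_n -> K, \sum_i c i *: b i = 0 -> forall i, c i = 0) /\
  (forall v : V, exists c : 'I_n -> K, v = \sum_i c i *: b i).

Definition has_dim (K : fieldType) (V : lmodType K) (n : nat) : Prop :=
  exists b : 'I_n -> V, is_basis b.

Definition torsion_free_rank (G : zmodType) (n : nat) : Prop :=
  has_dim (tensor rat G : lmodType rat) n.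

(* Main.v *)
From HB Require Import structures.
Require Import Defs.
From mathcomp Require Import finmap zify ring lra.

(* Write G = Z^j + H with j maximal, so that Hom(H, Z) = 0. Given n > 1,
   self-smallness bounds the p-primary parts of G; hence they split off, and, as
   they do not affect End_W(H), H may be assumed to have no n-torsion. Then
   H / nH is finite and torsion elements of H are divisible by n, so a unit of
   End_W(H) / n is given by a, b in End(H) inverse to each other on H / nH.

   Let C be a torsion-free group of finite rank, contained in Z[1/n]^(k+1), with
   an epimorphism phi : C -> H / nH. For X_a = {(h, c) | a h = phi c in H / nH},
   the relation diag(a, b) = product of elementary matrices modulo n yields
   H + X_a = H + X_1, so that X_a and X_1 are isomorphic by cancellation. If
   Hom(H, C) = 0, End(C) = Z and every homomorphism C -> H has image in n^2 H,
   then an isomorphism X_1 -> X_a induces an automorphism v of H and +1 or -1 on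
   C, and a v = +1 or -1 on H / nH. This lifts the given unit.

   Such a C is obtained by adjoining to Z^(k+1) the vectors
   (e_0 - sum_i D_i e_i) / n^m, with D in Z_n^k an n-adic vector: modulo torsion
   H is countable, so there are countably many homomorphisms to exclude, and
   each of them is excluded by refining a given approximation of D modulo n^m. *)

Set Implicit Arguments.
Unset Strict Implicit.
Unset Printing Implicit Defensive.

Import Order.TTheory GRing.Theory Num.Theory.
Local Open Scope ring_scope.

(** * Subgroups and Zorn's lemma *)

(** Cancellation supplies an isomorphism X_1 -> X_a about which nothing is known, so C must be rigid
    enough for every isomorphism to reveal a unit. A free C could be mapped to H arbitrarily.
    Denominators n^m along one direction force a divisibility by n^m for every m, and a generic D
    turns it into divisibility by n^2 of the images of the basis vectors. The square occurs because
    homomorphisms are read on the subgroup n H + n C of X_a: this costs a division by n, after which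
    the error must still lie in n H. Homomorphisms H -> C are excluded starting from Hom(H, Z) = 0,
    which prevents a nonzero one from staying inside a single finitely generated stage of C. An
    endomorphism of C is an integer matrix up to a power of n, with (1, -D) as an n-adic
    eigenvector; for generic D only scalar matrices have it. Since H may be uncountable,
    homomorphisms C -> H are enumerated by classes modulo torsion; torsion elements are divisible by
    all powers of n and do not affect the divisibility conditions. The sign is harmless, since the
    lift is the inverse of v multiplied by it. *)

Section MkHom.
Variables (A B : zmodType) (f : A -> B) (fP : zmod_morphism f).

Definition mk_hom : hom A B :=
  (HB.pack f (GRing.isZmodMorphism.Build A B f fP) : {additive A -> B}).

Lemma mk_homE x : mk_hom x = f x. Proof. by []. Qed.

End MkHom.

Definition hom_comp (A B C : zmodType) (f : hom B C) (g : hom A B) : hom A C :=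
  (f \o g : {additive A -> C}).

Lemma hom_mulrn (A B : zmodType) (f : hom A B) m x : (f *+ m) x = f x *+ m.
Proof. by elim: m => [|m IHm]; rewrite ?mulr0n // !mulrS homDE IHm. Qed.

Section Subgroups.
Variable G : zmodType.
Implicit Types (S T K M : set G).

Definition subgroup S := S 0 /\ forall x y, S x -> S y -> S (x - y).

Lemma subgroupN S x : subgroup S -> S x -> S (- x).
Proof. by move=> [S0 SB] Sx; rewrite -[- x]sub0r; apply: SB. Qed.

Lemma subgroupD S x y : subgroup S -> S x -> S y -> S (x + y).
Proof.
move=> Ss Sx Sy; rewrite -[y]opprK.
by apply: Ss.2 => //; apply: subgroupN.
Qed.

Lemma subgroupMn S x n : subgroup S -> S x -> S (x *+ n).
Proof.
move=> Ss Sx; elim: n => [|n IHn]; first by rewrite mulr0n; case: Ss.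
by rewrite mulrS; apply: subgroupD.
Qed.

Lemma subgroupMz S x a : subgroup S -> S x -> S (x *~ a).
Proof.
move=> Ss Sx; case: a => n; first exact: subgroupMn.
by rewrite NegzE mulrNz; apply: subgroupN => //; apply: subgroupMn.
Qed.

Lemma subgroup_sum S (I : Type) (r : seq I) (P : pred I) (F : I -> G) :
  subgroup S -> (forall i, P i -> S (F i)) -> S (\sum_(i <- r | P i) F i).
Proof.
move=> Ss SF; apply: big_ind => //; first by case: Ss.
by move=> x y; apply: subgroupD.
Qed.

(** Zorn's lemma for the subgroups that contain K and meet T inside K. If x is outside a maximal M,
    the subgroup generated by M and x meets T outside K, which yields t and a. *)
Lemma maximal_avoiding T K : subgroup T -> subgroup K ->
  exists M, [/\ subgroup M, (K `<=` M)%classic,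
    (forall t, T t -> M t -> K t)
    & forall x, ~ M x -> exists t a, [/\ T t, ~ K t & M (t - x *~ a)]].
Proof.
move=> Ts Ks.
pose good X := [/\ subgroup X, (K `<=` X)%classic & forall t, T t -> X t -> K t].
pose P X := X = set0 \/ good X.
have [F FP Ftot|M [[M0|[Ms KM TM]] Mmax]] := @Zorn_bigcup G P.
- have [[X FX [Xs KX TX]]|noX] := pselect (exists2 X, F X & good X); last first.
    left; apply/seteqP; split => // x [X FX Xx].
    case: (FP _ FX) => [X0|Xg]; first by rewrite X0 in Xx.
    by case: noX; exists X.
  right; split.
  + split; first by exists X => //; case: Xs.
    move=> x y [Y FY Yx] [Z FZ Zy].
    have [Yg Zg] : good Y /\ good Z.
      split; [case: (FP _ FY) => // Y0; by rewrite Y0 in Yx|].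
      by case: (FP _ FZ) => // Z0; rewrite Z0 in Zy.
    case: (Ftot Y Z FY FZ) => sub; [exists Z => // | exists Y => //].
      by case: Zg => Zs _ _; apply: Zs.2 => //; apply: sub.
    by case: Yg => Ys _ _; apply: Ys.2 => //; apply: sub.
  + by move=> x Kx; exists X => //; apply: KX.
  + move=> t Tt [Y FY Yt]; case: (FP _ FY) => [Y0|[_ _]]; last exact.
    by rewrite Y0 in Yt.
- exfalso; apply: (Mmax K); last by right; split.
  by rewrite M0; split => // /(_ 0); apply; case: Ks.
exists M; split => // x Mx; apply: contrapT => no.
pose M' : set G := [set y | exists z a, M z /\ y = z + x *~ a]%classic.
apply: (Mmax M').
  split; first by move=> y My; exists y, 0; rewrite mulr0z addr0.
  move=> /(_ x) xM; apply/Mx/xM.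
  by exists 0, 1; split; [case: Ms | rewrite add0r].
right; split.
- split; first by exists 0, 0; split; [case: Ms | rewrite mulr0z addr0].
  move=> _ _ [z [a [Mz ->]]] [z' [a' [Mz' ->]]].
  exists (z - z'), (a - a'); split; first exact: Ms.2.
  by rewrite mulrzBr opprD addrACA.
- by move=> y Ky; exists y, 0; split; [apply: KM | rewrite mulr0z addr0].
move=> t Tt [z [a [Mz tE]]]; apply: contrapT => Kt.
by apply: no; exists t, a; split => //; rewrite tE addrK.
Qed.

Fact subgroup_zmod_closed S : subgroup S -> zmod_closed (fun x => `[< S x >]).
Proof.
move=> [S0 SB]; split; first exact/asboolP.
by move=> x y /asboolP Sx /asboolP Sy; apply/asboolP/SB.
Qed.

Definition closed_of S (Ss : subgroup S) : zmodClosed G :=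
  HB.pack (fun x => `[< S x >])
    (GRing.isZmodClosed.Build G (fun x => `[< S x >]) (subgroup_zmod_closed Ss)).

Lemma closed_ofP S (Ss : subgroup S) x : reflect (S x) (x \in closed_of Ss).
Proof. exact: asboolP. Qed.

End Subgroups.

Section SubgroupType.
Variables (V : zmodType) (S : zmodClosed V).

Record subgrp := Subgrp { subgrp_val :> V; _ : subgrp_val \in S }.
HB.instance Definition _ := [isSub for subgrp_val].
HB.instance Definition _ := [Choice of subgrp by <:].
HB.instance Definition _ := [SubChoice_isSubZmodule of subgrp by <:].

Fact subgrp_inc_proof : zmod_morphism subgrp_val.
Proof. by []. Qed.
Definition subgrp_inc : hom subgrp V := mk_hom subgrp_inc_proof.

End SubgroupType.

Arguments subgrp_val {V S} _.

(** * Isomorphisms and retracts *)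

Lemma zmod_iso_can (A B : zmodType) (f : A -> B) (g : B -> A) :
  zmod_morphism f -> cancel f g -> cancel g f -> zmod_iso A B.
Proof. by move=> fP fK gK; exists (mk_hom fP); exists g. Qed.

Lemma zmod_iso_homs (A B : zmodType) : zmod_iso A B ->
  exists (f : hom A B) (g : hom B A), cancel f g /\ cancel g f.
Proof.
move=> [f [g fK gK]]; exists f.
have gP : zmod_morphism g by move=> x y; apply: (can_inj fK); rewrite raddfB !gK.
by exists (mk_hom gP).
Qed.

Lemma zmod_iso_sym (A B : zmodType) : zmod_iso A B -> zmod_iso B A.
Proof.
by move=> /zmod_iso_homs [f [g [fK gK]]]; apply: (zmod_iso_can (raddfB g) gK fK).
Qed.

Lemma zmod_iso_refl (A : zmodType) : zmod_iso A A.
Proof. exact: (@zmod_iso_can A A id id). Qed.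

Lemma zmod_iso_trans (A B C : zmodType) :
  zmod_iso A B -> zmod_iso B C -> zmod_iso A C.
Proof. by move=> [f fB] [g gB]; exists (g \o f : {additive A -> C}); apply: bij_comp. Qed.

Lemma zmod_iso_prod (A B C D : zmodType) :
  zmod_iso A B -> zmod_iso C D -> zmod_iso (A * C)%type (B * D)%type.
Proof.
move=> /zmod_iso_homs [f [f' [fK f'K]]] /zmod_iso_homs [g [g' [gK g'K]]].
apply: (@zmod_iso_can _ _ (fun x => (f x.1, g x.2)) (fun y => (f' y.1, g' y.2))).
- by move=> x y; rewrite /= !raddfB.
- by move=> [x y]; rewrite /= fK gK.
- by move=> [x y]; rewrite /= f'K g'K.
Qed.

Lemma zmod_iso_prodA (A B C : zmodType) :
  zmod_iso (A * (B * C))%type ((A * B) * C)%type.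
Proof.
by apply: (@zmod_iso_can _ _ (fun x => ((x.1, x.2.1), x.2.2))
  (fun y => (y.1.1, (y.1.2, y.2)))) => [x y|[x [y z]]|[[x y] z]].
Qed.

(** Direct summands are represented by an inclusion [i] and a projection [p] with [cancel i p]; here
    the summand consists of the fixed points of the idempotent. *)
Lemma idem_retract (H : zmodType) (q : hom H H) : (forall x, q (q x) = q x) ->
  exists (H' : zmodType) (i : hom H' H) (p : hom H H'),
    cancel i p /\ forall x, i (p x) = q x.
Proof.
move=> qq.
have Ms : subgroup [set x | q x = x]%classic.
  by split=> [|x y /= qx qy]; rewrite /= ?raddf0 // raddfB qx qy.
have qM x : q x \in closed_of Ms by apply/closed_ofP; rewrite /= qq.
have pP : zmod_morphism (fun x => Subgrp (qM x)).
  by move=> x y; apply: val_inj; rewrite /= raddfB.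
exists (subgrp (closed_of Ms) : zmodType), (subgrp_inc _), (mk_hom pP).
split=> // -[x xM]; apply: val_inj; have /closed_ofP := xM; exact.
Qed.

Section Retract.
Variables (H H' : zmodType) (i : hom H' H) (p : hom H H') (ipK : cancel i p).

Lemma retract_complement : exists K : zmodType, zmod_iso H (K * H')%type.
Proof.
have Ks : subgroup [set x | p x = 0]%classic.
  by split=> [|x y /= px py]; rewrite /= ?raddf0 // raddfB px py subr0.
have kP x : x - i (p x) \in closed_of Ks.
  by apply/closed_ofP; rewrite /= raddfB ipK subrr.
exists (subgrp (closed_of Ks) : zmodType).
pose f x := (Subgrp (kP x), p x).
pose g (y : subgrp (closed_of Ks) * H') : H := subgrp_val y.1 + i y.2.
apply: (@zmod_iso_can H (subgrp (closed_of Ks) * H')%type f g).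
- move=> x y; rewrite -[RHS]/(Subgrp (kP x) - Subgrp (kP y), p x - p y).
  congr pair; last exact: raddfB.
  by apply: val_inj; rewrite /= !raddfB /= addrACA.
- by move=> x; rewrite /g /= subrK.
- move=> [[k kK] y]; rewrite /g /f /=; have /closed_ofP /= pk := kK.
  have pE : p (k + i y) = y by rewrite raddfD pk add0r ipK.
  by congr pair; [apply: val_inj; rewrite /= pE addrK | exact: pE].
Qed.

Lemma retract_cancellation : cancellation_property H -> cancellation_property H'.
Proof.
move=> Hc A B AB; apply: Hc; have [K HK] := retract_complement.
have aux (X : zmodType) : zmod_iso (H * X)%type (K * (H' * X))%type.
  apply: zmod_iso_trans (zmod_iso_prod HK (zmod_iso_refl X)) _.
  exact/zmod_iso_sym/zmod_iso_prodA.
apply: zmod_iso_trans (aux A) _.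
apply: zmod_iso_trans (zmod_iso_prod (zmod_iso_refl K) AB) _.
exact/zmod_iso_sym/aux.
Qed.

End Retract.

(** The component in M is unique because T and M meet in 0, and uniqueness makes it additive. *)
Lemma complement_retract (G : zmodType) (T M : set G) :
  subgroup T -> subgroup M -> (forall t, T t -> M t -> t = 0) ->
  (forall x, exists2 t, T t & M (x - t)) ->
  exists (H : zmodType) (i : hom H G) (p : hom G H),
    [/\ cancel i p, forall x, M (i (p x)) & forall x, T (x - i (p x))].
Proof.
move=> Ts Ms TM TMG; have [q qP] : {q : G -> G & forall x, T (x - q x) /\ M (q x)}.
  apply: (@boolp.choice G G (fun x y => T (x - y) /\ M y)) => x.
  by have [t Tt Mxt] := TMG x; exists (x - t); rewrite subKr.
have qU x y : T (x - y) -> M y -> y = q x.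
  move=> Txy My; have [Tq Mq] := qP x; apply/eqP; rewrite -subr_eq0; apply/eqP.
  apply: TM; last by apply: Ms.2.
  have -> : y - q x = (x - q x) - (x - y) by rewrite opprB [RHS]addrC subrKA.
  exact: Ts.2.
have qB : zmod_morphism q.
  move=> x y; apply/esym/qU; have [[Tx Mx] [Ty My]] := (qP x, qP y); last exact: Ms.2.
  by have -> : x - y - (q x - q y) = (x - q x) - (y - q y);
    [rewrite !opprB addrACA [in RHS]addrACA [- y - _]addrC | apply: Ts.2].
have [|H [i [p [ipK ip]]]] := @idem_retract G (mk_hom qB).
  by move=> x; apply/esym/qU; [rewrite subrr; case: Ts | case: (qP x)].
by exists H, i, p; split=> // x; rewrite ip; case: (qP x).
Qed.

(** * Primary parts of self-small groups *)

(** The family is a homomorphism from G to a countable direct sum of copies of G, and by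
    self-smallness it comes from an element of finite support. Later uses contradict this with
    families all of whose members are nonzero. *)
Lemma self_small_family (G : zmodType) (f : nat -> hom G G) : self_small G ->
  (forall x, exists N, forall j, (N <= j)%N -> f j x = 0) ->
  exists N, forall j, (N <= j)%N -> f j = 0.
Proof.
move=> Gss f0.
have supp x : (fun j => f j x) \in @finite_supp nat G.
  have [N fN] := f0 x; apply/finite_suppP.
  apply: (sub_finite_set _ (finite_II N)) => j /= fj.
  by rewrite ltnNge; apply: contra fj => /fN ->.
have FP : zmod_morphism (fun x => Dsum (supp x)).
  by move=> x y; apply: dsumP => j /=; rewrite raddfB.
have [g _ gK] := Gss nat; have := gK (mk_hom FP); set Phi := g _ => PhiE.
have Phif j : Phi j = f j.
  by apply: homP => x; have /(congr1 (fun h : hom G (dsum nat G) => h x j)) := PhiE.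
have /finite_fsetP [A AE] := dsum_finite Phi.
exists (\max_(j <- A) j.+1)%N => j Aj; apply/eqP; rewrite -Phif; apply: contraLR Aj => Phij.
have jA : j \in A by have : [set` A]%classic j by rewrite -AE.
by rewrite -ltnNge; apply: (@leq_bigmax_seq _ _ predT (fun j => j.+1)).
Qed.

Lemma bezout_prime (q : nat) (a : int) : prime q -> ~~ (q%:Z %| a)%Z ->
  exists u v, u * a + v * q%:Z = 1.
Proof.
move=> qp qa; have [u [v uv]] := Bezoutz a q; exists u, v; rewrite uv.
apply/eqP; rewrite -/(coprimez _ _) coprimez_sym.
by rewrite coprimezE absz_nat prime_coprime // -dvdzE.
Qed.

Section PrimeSubgroups.
Variables (G : zmodType) (q : nat) (q_prime : prime q).
Implicit Types (S T K M D : set G).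

Lemma prime_subgroup M x a : subgroup M -> M (x *+ q) -> M (x *~ a) ->
  ~~ (q%:Z %| a)%Z -> M x.
Proof.
move=> Ms Mq Ma /(bezout_prime q_prime) [u [v uv]].
rewrite -[x]mulr1z -uv mulrzDr; apply: subgroupD => //.
  by rewrite mulrC mulrzA; apply: subgroupMz.
by rewrite mulrC mulrzA; apply: subgroupMz.
Qed.

(** Maximality gives t and a with t - a x in M, and q does not divide a, since otherwise t would lie
    in M. So a is invertible modulo q, and q x in M puts x into T + M. *)
Lemma maximal_avoiding_prime T K M x : subgroup T -> subgroup M ->
  (K `<=` M)%classic -> (forall t, T t -> M t -> K t) ->
  (forall x, ~ M x -> exists t a, [/\ T t, ~ K t & M (t - x *~ a)]) ->
  M (x *+ q) -> exists2 t, T t & M (x - t).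
Proof.
move=> Ts Ms KM TM maxM Mqx; apply: contrapT => xTM.
have Mx : ~ M x by move=> Mx; apply: xTM; exists 0; rewrite ?subr0 //; case: Ts.
have [t [a [Tt Kt Mta]]] := maxM x Mx.
have qa : ~~ (q%:Z %| a)%Z.
  apply/negP => /dvdzP [b ab]; apply: Kt; apply: TM => //.
  rewrite -[t](subrK (x *~ a)); apply: subgroupD => //.
  by rewrite ab mulrC mulrzA -pmulrn; apply: subgroupMz.
have [u [v uv]] := bezout_prime q_prime qa; apply: xTM.
exists (t *~ u); first by apply: subgroupMz.
have -> : x - t *~ u = (x *+ q) *~ v - (t - x *~ a) *~ u.
  rewrite -[in LHS](mulr1z x) -uv mulrzDr mulrzBl opprB [RHS]addrA.
  by rewrite [u * a]mulrC [v * _]mulrC !mulrzA -pmulrn [X in X - _]addrC.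
by apply: Ms.2; apply: subgroupMz.
Qed.

(** G / K is a vector space over F_q, and M / K is a complement of the image of T. *)
Lemma complement_mod_prime T K : subgroup T -> subgroup K ->
  (forall x, K (x *+ q)) ->
  exists M, [/\ subgroup M, (K `<=` M)%classic, (forall t, T t -> M t -> K t)
    & forall x, exists2 t, T t & M (x - t)].
Proof.
move=> Ts Ks qK; have [M [Ms KM TM maxM]] := maximal_avoiding Ts Ks.
by exists M; split=> // x; apply: (maximal_avoiding_prime Ts Ms KM TM maxM); apply: KM.
Qed.

(** A linear form on the F_q-space G / K with value 1 at x, followed by the map F_q -> G that sends
    1 to t. *)
Lemma functional_mod_prime K x t : subgroup K -> (forall y, K (y *+ q)) ->
  ~ K x -> t *+ q = 0 ->
  exists g : hom G G, (forall y, K y -> g y = 0) /\ g x = t.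
Proof.
move=> Ks qK Kx tq.
have Zs : subgroup [set y | exists a, y = x *~ a]%classic.
  split; first by exists 0; rewrite mulr0z.
  by move=> _ _ [a ->] [b ->]; exists (a - b); rewrite mulrzBr.
have [M [Ms KM TM spanM]] := complement_mod_prime Zs Ks qK.
have {}spanM y : exists a, M (y - x *~ a) by have [_ [a ->]] := spanM y; exists a.
have xM a : M (x *~ a) -> t *~ a = 0.
  move=> Mxa; have [/dvdzP [b ->]|qa] := boolP (q%:Z %| a)%Z.
    by rewrite mulrC mulrzA -pmulrn tq mul0rz.
  case: Kx; apply: (prime_subgroup Ks (qK x) _ qa).
  by apply: TM => //; exists a.
have [a aP] := @boolp.choice _ _ (fun y a => M (y - x *~ a)) spanM.
have aE y b : M (y - x *~ b) -> t *~ a y = t *~ b.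
  move=> Myb; apply/eqP; rewrite -subr_eq0 -mulrzBr; apply/eqP/xM.
  have -> : x *~ (a y - b) = (y - x *~ b) - (y - x *~ a y).
    by rewrite opprB [RHS]addrC subrKA mulrzBr.
  exact: Ms.2.
have gP : zmod_morphism (fun y => t *~ a y).
  move=> y z; rewrite -mulrzBr; apply: aE.
  have -> : y - z - x *~ (a y - a z) = (y - x *~ a y) - (z - x *~ a z).
    by rewrite mulrzBr !opprB addrACA [in RHS]addrACA [- z - _]addrC.
  exact: Ms.2.
exists (mk_hom gP); split=> [y Ky|]; rewrite mk_homE.
  by rewrite (aE y 0) ?mulr0z // subr0; apply: KM.
by rewrite (aE x 1) // subrr; case: Ms.
Qed.

End PrimeSubgroups.

Section BoundedPrimaryPart.
Variables (G : zmodType) (q : nat) (q_prime : prime q).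
Implicit Types (S T K M D : set G).

(** Functionals [f j] that vanish on [V j] and take the value t at [x j] are all nonzero, but at
    each point almost all of them vanish. *)
Lemma chain_not_self_small (S : nat -> set G) (x : nat -> G) (t : G) :
  (forall j, subgroup (S j)) -> (forall y, S 0%N (y *+ q)) ->
  (forall j, (S j `<=` S j.+1)%classic) ->
  (forall j, S j.+1 (x j)) -> (forall j, ~ S j (x j)) ->
  t != 0 -> t *+ q = 0 -> ~ self_small G.
Proof.
move=> Ss S0 SS Sx nSx t0 tq Gss.
have Sle j k : (j <= k)%N -> (S j `<=` S k)%classic.
  move=> /subnK <-; elim: (k - j)%N => [|i IHi] y Sy //.
  by rewrite addSn; apply/SS/IHi.
pose U := [set y | exists j, S j y]%classic.
have Us : subgroup U.
  split; first by exists 0%N; case: (Ss 0%N).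
  move=> y z [j Sy] [k Sz]; exists (maxn j k); apply: (Ss _).2.
    by apply: Sle Sy; apply: leq_maxl.
  by apply: Sle Sz; apply: leq_maxr.
have qS j y : S j (y *+ q) by apply: (Sle 0%N) => //; apply: S0.
have [W [Ws SW UW spanW]] := complement_mod_prime q_prime Us (Ss 0%N) S0.
(* The [S j] exhaust only U; enlarged by the complement W they exhaust G, and [V j] still misses
   [x j]. *)
pose V j := [set y | exists2 s, S j s & W (y - s)]%classic.
have Vs j : subgroup (V j).
  split; first by exists 0; rewrite ?subr0; [case: (Ss j) | case: Ws].
  move=> y z [s Sjs Wys] [s' Sjs' Wzs']; exists (s - s'); first exact: (Ss j).2.
  have -> : y - z - (s - s') = (y - s) - (z - s').
    by rewrite !opprB addrACA [in RHS]addrACA [- z - _]addrC.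
  exact: Ws.2.
have qV j y : V j (y *+ q).
  by exists (y *+ q); rewrite ?subrr //; case: Ws.
have nVx j : ~ V j (x j).
  move=> [s Sjs Wxs]; apply: (nSx j).
  rewrite -[x j](subrK s); apply: subgroupD => //.
  apply: (Sle 0%N) => //; apply: UW => //; exists j.+1.
  by apply: (Ss _).2 => //; apply: SS.
have [f fP] := @boolp.choice nat (hom G G)
  (fun j g => (forall y, V j y -> g y = 0) /\ g (x j) = t)
  (fun j => functional_mod_prime q_prime (Vs j) (qV j) (@nVx j) tq).
have [y|N fN] := self_small_family (f := f) Gss.
  have [s [N SNs] Wys] := spanW y; exists N => j Nj.
  by apply: (fP j).1; exists s => //; apply: Sle SNs.
by move: t0; rewrite -(fP N).2 fN // eqxx.
Qed.

(** D is divisible, hence a direct summand. If psi is the projection onto D, the maps q^j psi vanish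
    eventually at each point because D is q-primary, but none is zero because D is q-divisible. *)
Lemma divisible_not_self_small D d0 : subgroup D ->
  (forall d, D d -> exists2 d', D d' & d = d' *+ q) ->
  (forall d, D d -> exists m, d *+ (q ^ m) = 0) ->
  D d0 -> d0 != 0 -> ~ self_small G.
Proof.
move=> Ds Dq Dt Dd0 d0_neq0 Gss.
have Ddiv l d : prime l -> D d -> exists2 d', D d' & d = d' *+ l.
  move=> lp Dd; have [->|lq] := eqVneq l q; first exact: Dq.
  have [m dm] := Dt d Dd.
  have cop : ~~ (l%:Z %| (q ^ m)%N%:Z)%Z.
    by rewrite dvdzE /= Euclid_dvdX // negb_and dvdn_prime2 // lq.
  have [u [v uv]] := bezout_prime lp cop.
  exists (d *~ v); first exact: subgroupMz.
  have {}dm : d *~ (q ^ m)%N%:Z = 0 by rewrite -pmulrn.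
  by rewrite -[in LHS](mulr1z d) -uv mulrzDr [u * _]mulrC !mulrzA dm mul0rz add0r.
have Zs : subgroup [set (0 : G)]%classic by split=> // _ _ -> ->; rewrite subr0.
have [M [Ms _ DM maxM]] := maximal_avoiding Ds Zs.
have DMG x : exists2 d, D d & M (x - d).
  apply: contrapT => xDM.
  have nM y : ~ (exists2 d, D d & M (y - d)) -> ~ M y.
    by move=> yDM My; apply: yDM; exists 0; rewrite ?subr0 //; case: Ds.
  (* Baer's argument: for the least a > 0 with a x in D + M and a prime l dividing a, divisibility
     of D by l would bring (a / l) x into D + M. *)
  pose P a := (0 < a)%N && `[< exists2 d, D d & M (x *+ a - d) >].
  have exP : exists a, P a.
    have [d [a [Dd d_neq0 Mda]]] := maxM x (nM x xDM).
    have aN0 : a != 0.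
      by apply/eqP => a0; apply: d_neq0; apply: DM => //; move: Mda; rewrite a0 subr0.
    exists `|a|%N; rewrite /P absz_gt0 aN0; apply/asboolP.
    have [a0|a0] := leP 0 a.
      exists d => //; rewrite -opprB; apply: subgroupN => //.
      by rewrite pmulrn gez0_abs.
    exists (- d); first exact: subgroupN.
    by rewrite opprK pmulrn ltz0_abs // mulrNz addrC.
  case: (ex_minnP exP) => a /andP [a0 /asboolP [d Dd Mad]] mina.
  have a1 : (1 < a)%N.
    rewrite ltn_neqAle a0 andbT; apply/eqP => a1; apply: xDM.
    by exists d; rewrite // -[x]mulr1n a1.
  have lp := pdiv_prime a1; set l := pdiv a in lp.
  have [b aE] : exists b, a = (b * l)%N by apply/dvdnP/pdiv_dvd.
  have b0 : (0 < b)%N by move: a0; rewrite aE muln_gt0 => /andP [].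
  have xb : ~ (exists2 d, D d & M (x *+ b - d)).
    move=> xb; have /mina : P b by rewrite /P b0; apply/asboolP.
    rewrite aE leqNgt => /negP; apply.
    by rewrite -[ltnLHS]muln1 ltn_pmul2l // prime_gt1.
  have [d' Dd' dE] := Ddiv l d lp Dd.
  pose y := x *+ b - d'.
  have My : M (y *+ l) by rewrite mulrnBl -mulrnA -aE -dE.
  have yDM : ~ (exists2 d, D d & M (y - d)).
    move=> [e De]; rewrite /y -addrA -opprD => ?.
    by apply: xb; exists (d' + e) => //; apply: subgroupD.
  by apply: yDM; apply: (maximal_avoiding_prime lp Ds Ms _ DM maxM My) => _ ->; case: Ms.
have MD0 t : M t -> D t -> t = 0 by move=> Mt Dt'; apply: DM.
have [x|H [i [p [_ Dip Mip]]]] := complement_retract Ms Ds MD0.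
  by have [d Dd Mxd] := DMG x; exists (x - d) => //; rewrite subKr.
pose psi : hom G G := i \o p.
have psiD d : D d -> psi d = d.
  move=> Dd; apply/eqP; rewrite eq_sym -subr_eq0; apply/eqP/MD0; first exact: Mip.
  by apply: Ds.2 => //; apply: Dip.
have [x|N /(_ N (leqnn N)) psiN] := self_small_family (f := fun j => psi *+ (q ^ j)) Gss.
  have [m xm] := Dt _ (Dip x); exists m => j mj.
  by rewrite hom_mulrn -(subnK mj) expnD mulnC mulrnA xm mul0rn.
have [e De eE] : exists2 e, D e & e *+ (q ^ N) = d0.
  elim: (N) => [|k [e De <-]]; first by exists d0; rewrite // mulr1n.
  by have [e' De' ->] := Dq e De; exists e' => //; rewrite -mulrnA expnS.
have := congr1 (fun h : hom G G => h e) psiN.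
by rewrite /= hom_mulrn psiD // eE => d00; rewrite d00 eqxx in d0_neq0.
Qed.

Definition primary_part : set G := [set x | exists m, x *+ (q ^ m) = 0]%classic.

Lemma primary_part_subgroup : subgroup primary_part.
Proof.
split; first by exists 0%N; rewrite mul0rn.
move=> x y [m xm] [k yk]; exists (m + k)%N.
by rewrite mulrnBl expnD mulrnA xm mul0rn mulnC mulrnA yk mul0rn subrr.
Qed.

Fixpoint span_mod (l : seq G) : set G :=
  if l is x :: l' then [set y | exists a, span_mod l' (y - x *~ a)]%classic
  else [set y | exists g, y = g *+ q]%classic.

Lemma span_mod_subgroup l : subgroup (span_mod l).
Proof.
elim: l => [|x l IHl] /=.
  split; first by exists 0; rewrite mul0rn.
  by move=> _ _ [g ->] [h ->]; exists (g - h); rewrite mulrnBl.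
split; first by exists 0; rewrite subr0; case: IHl.
move=> y z [a ya] [b zb]; exists (a - b).
have -> : y - z - x *~ (a - b) = (y - x *~ a) - (z - x *~ b).
  by rewrite mulrzBr !opprB addrACA [in RHS]addrACA [- z - _]addrC.
exact: IHl.2.
Qed.

Lemma span_mod_primary l : (forall x, x \in l -> primary_part x) ->
  exists s, forall y, span_mod l y -> exists e g, y = e + g *+ q /\ e *+ (q ^ s) = 0.
Proof.
elim: l => [|x l IHl] lT /=.
  by exists 0%N => _ [g ->]; exists 0, g; rewrite add0r mul0rn.
have [s sP] := IHl (fun y yl => lT y (@mem_behead _ (x :: l) y yl)).
have [m xm] := lT x (mem_head x l).
exists (s + m)%N => y [a /sP [e [g [yE es]]]].
exists (e + x *~ a), g; split; first by rewrite addrAC -yE subrK.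
rewrite mulrnDl expnD mulrnA es mul0rn add0r mulnC mulrnA.
by rewrite [_ *+ q ^ m]pmulrn -mulrzA mulrC mulrzA -pmulrn xm mul0rz mul0rn.
Qed.

(** If finitely many elements of the primary part T span it modulo q G, then some q^s T is
    q-divisible and therefore zero. Otherwise T contains a sequence in which each member is outside
    the span of its predecessors modulo q G, and these spans form a strictly ascending chain. *)
Lemma self_small_primary_bounded : self_small G ->
  exists s, forall x, primary_part x -> x *+ (q ^ s) = 0.
Proof.
move=> Gss; have Ts := primary_part_subgroup.
have [[x0 Tx0 x0_neq0]|T0] := pselect (exists2 x, primary_part x & x != 0); last first.
  exists 0%N => x Tx; rewrite mulr1n; apply/eqP; apply: contrapT => x0.
  by apply: T0; exists x => //; apply/negP.
have [t t0 tq] : exists2 t : G, t != 0 & t *+ q = 0.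
  have [m xm] := Tx0; elim: m x0_neq0 xm => [|m IHm] x00 xm.
    by rewrite mulr1n in xm; rewrite xm eqxx in x00.
  have [/(IHm x00)//|xm0] := eqVneq (x0 *+ q ^ m) 0.
  by exists (x0 *+ q ^ m) => //; rewrite -mulrnA -expnSr.
have [[l lT spanT]|noT] := pselect (exists2 l, forall x, x \in l -> primary_part x &
    (primary_part `<=` span_mod l)%classic).
  have [s sP] := span_mod_primary lT; exists s => x Tx.
  apply: contrapT => /eqP xs0.
  pose D := [set y | exists2 t, primary_part t & y = t *+ q ^ s]%classic.
  apply: (@divisible_not_self_small D (x *+ q ^ s)) Gss => //; last by exists x.
  - split; first by exists 0; rewrite ?mul0rn //; case: Ts.
    move=> _ _ [y Ty ->] [z Tz ->]; exists (y - z); last by rewrite mulrnBl.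
    exact: Ts.2.
  - move=> _ [y Ty ->]; have [e [g [yE es]]] := sP _ (spanT _ Ty).
    have Tg : primary_part g.
      have [m ym] := Ty; exists (s + m).+1.
      rewrite expnS mulrnA; have -> : g *+ q = y - e by rewrite yE addrC addKr.
      by rewrite mulrnBl [in y *+ _]addnC !expnD mulrnA ym mul0rn mulrnA es mul0rn subr0.
    exists (g *+ q ^ s); first by exists g.
    by rewrite yE mulrnDl es add0r mulrnAC.
  - move=> _ [y [m ym] ->]; exists m.
    by rewrite mulrnAC ym mul0rn.
have next l : exists x, (forall y, y \in l -> primary_part y) ->
    primary_part x /\ ~ span_mod l x.
  have [lT|nlT] := pselect (forall y, y \in l -> primary_part y); last by exists 0.
  apply: contrapT => no; apply: noT; exists l => // x Tx; apply: contrapT => lx.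
  by apply: no; exists x.
have [x xP] := @boolp.choice _ _ _ next.
pose l := fix l j := if j is j'.+1 then x (l j') :: l j' else [::].
have lT j y : y \in l j -> primary_part y.
  elim: j y => [|j IHj] y //=; rewrite inE => /predU1P [->|/IHj//].
  by case: (xP _ IHj).
exfalso.
apply: (@chain_not_self_small (fun j => span_mod (l j)) (fun j => x (l j)) t) Gss => //.
- by move=> j; apply: span_mod_subgroup.
- by move=> y; exists y.
- by move=> j y ly; exists 0; rewrite subr0.
- by move=> j; exists 1; rewrite mulr1z subrr; case: (span_mod_subgroup (l j)).
- by move=> j; case: (xP _ (lT j)).
Qed.

End BoundedPrimaryPart.

(** A bounded pure subgroup is a direct summand. The complement is reached in s steps from q^s G:
    after j steps M meets T in 0 and each q^(s-j) x is in q^(s-j) T + M. *)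
Lemma primary_part_retract (G : zmodType) (q s : nat) : prime q ->
  (forall x : G, @primary_part G q x -> x *+ (q ^ s) = 0) ->
  exists (H : zmodType) (i : hom H G) (p : hom G H),
    [/\ cancel i p, forall x, x - i (p x) \in torsion_part G
      & forall y : H, y *+ q = 0 -> y = 0].
Proof.
move=> qp Tbd; have q0 := prime_gt0 qp; have Ts := @primary_part_subgroup G q.
set T := @primary_part G q in Ts Tbd.
have Tpure (x : G) m : T (x *+ q ^ m) -> T x.
  by move=> [k xk]; exists (m + k)%N; rewrite expnD mulrnA.
pose A j := [set y : G | exists x, y = x *+ q ^ j]%classic.
have As j : subgroup (A j).
  split; first by exists 0; rewrite mul0rn.
  by move=> _ _ [x ->] [y ->]; exists (x - y); rewrite mulrnBl.
have step j : (j <= s)%N -> exists M, [/\ subgroup M, (forall t, T t -> M t -> t = 0)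
    & forall x, exists2 t, T t & M ((x - t) *+ q ^ (s - j))].
  elim: j => [_|j IHj js].
    exists (A s); split=> // [t Tt [x xE]|x].
      by rewrite xE; apply/Tbd/(Tpure _ s); rewrite -xE.
    by exists 0; [case: Ts | rewrite subr0 subn0; exists x].
  have [K [Ks TK spanK]] := IHj (ltnW js).
  set k := (s - j.+1)%N; have kE : (s - j)%N = k.+1 by rewrite -subSn ?subSS.
  pose T' := [set y | exists2 t, T t & y = t *+ q ^ k]%classic.
  have T's : subgroup T'.
    split; first by exists 0; rewrite ?mul0rn //; case: Ts.
    move=> _ _ [y Ty ->] [z Tz ->]; exists (y - z); last by rewrite mulrnBl.
    exact: Ts.2.
  have T'T y : T' y -> T y by move=> [t Tt ->]; apply: subgroupMn.
  have [M [Ms KM TM maxM]] := maximal_avoiding T's Ks.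
  (* Maximality controls M only on q^k T. Intersecting with q^k G extends this to T, because q^k x
     in T implies x in T. *)
  exists [set y | M y /\ A k y]%classic; split.
  - split; first by split; [case: Ms | case: (As k)].
    by move=> x y [Mx Ax] [My Ay]; split; [apply: Ms.2 | apply: (As k).2].
  - move=> t Tt [Mt [x xE]]; apply: TK => //; apply: TM => //.
    by exists x => //; apply: (Tpure _ k); rewrite -xE.
  move=> x; have [t Tt Kxt] := spanK x.
  have [|_ [t' Tt' ->] Mxt] :=
    @maximal_avoiding_prime G q qp T' K M ((x - t) *+ q ^ k) T's Ms KM TM maxM.
    by apply: KM; rewrite -mulrnA mulnC -expnS -kE.
  exists (t + t'); first exact: subgroupD.
  by split; [rewrite opprD addrA mulrnBl | exists (x - (t + t'))].
have [M [Ms TM spanM]] := step s (leqnn s).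
have [x|H [i [p [ipK Mip Tip]]]] := complement_retract Ts Ms TM.
  by have [t Tt] := spanM x; rewrite subnn mulr1n; exists t.
exists H, i, p; split=> // [x|y yq].
  by have [m xm] := Tip x; apply/torsionP; exists (q ^ m)%N; rewrite ?expn_gt0 ?q0.
have iy0 : i y = 0.
  apply: TM; last by rewrite -[y]ipK.
  by exists 1%N; rewrite expn1 -raddfMn yq raddf0.
by rewrite -[y]ipK iy0 raddf0.
Qed.

(** The prime factors of n are removed one by one. Every intermediate retract embeds in G, which
    supplies the bound on its primary part. *)
Lemma torsion_free_retract (G : zmodType) (n : nat) : (0 < n)%N -> self_small G ->
  forall (G0 : zmodType) (i0 : hom G0 G) (p0 : hom G G0), cancel i0 p0 ->
  exists (H : zmodType) (i : hom H G0) (p : hom G0 H),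
    [/\ cancel i p, forall x, x - i (p x) \in torsion_part G0
      & forall y : H, y *+ n = 0 -> y = 0].
Proof.
move=> n0 Gss; elim/ltn_ind: n n0 => n IHn n0 G0 i0 p0 ip0K.
have [n1|n1] := leqP n 1%N.
  exists G0, (idfun : {additive G0 -> G0}), (idfun : {additive G0 -> G0}).
  split=> // [x|y]; first by rewrite subrr rpred0.
  by have -> : n = 1%N by lia.
have qp := pdiv_prime n1; set q := pdiv n in qp.
have [m nE] : exists m, n = (m * q)%N by apply/dvdnP/pdiv_dvd.
have m0 : (0 < m)%N by move: n0; rewrite nE muln_gt0 => /andP [].
have mn : (m < n)%N by rewrite nE -[ltnLHS]muln1 ltn_pmul2l // prime_gt1.
have [H1 [i1 [p1 [ip1K tors1 mH1]]]] := IHn m mn m0 G0 i0 p0 ip0K.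
have [s sP] := self_small_primary_bounded qp Gss.
have [x [k xk]|H [i [p [ipK tors qH]]]] := @primary_part_retract H1 q s qp.
  apply: (can_inj ip1K); apply: (can_inj ip0K); rewrite !raddfMn !raddf0.
  by apply: sP; exists k; rewrite -!raddfMn xk !raddf0.
exists H, (i1 \o i : {additive _ -> _}), (p \o p1 : {additive _ -> _}).
split=> [x|x|y].
- by rewrite /= ip1K ipK.
- rewrite -[x in x - _](subrK (i1 (p1 x))) -addrA -raddfB; apply: rpredD => //.
  apply/torsionP.
  have /torsionP [l l0 lx] := tors (p1 x); exists l => //.
  by rewrite -raddfMn lx raddf0.
rewrite nE mulrnA => /qH ym.
apply: (can_inj ipK); rewrite raddf0; apply: mH1.
by rewrite -raddfMn ym raddf0.
Qed.

(** * Torsion-free rank *)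

Lemma torsionPz (G : zmodType) (x : G) (a : int) :
  a != 0 -> x *~ a = 0 -> x \in torsion_part G.
Proof.
move=> a0 xa; apply/torsionP; exists `|a|%N; first by rewrite absz_gt0.
have [ap|an] := leP 0 a; first by rewrite pmulrn gez0_abs.
by rewrite pmulrn ltz0_abs // mulrNz xa oppr0.
Qed.

(** Let M be maximal among the subgroups meeting Z g in 0. Each x satisfies a x - b g in M with a
    nonzero, and x is sent to b / a; this is well defined because g has infinite order. *)
Lemma hom_to_rat (G : zmodType) (g : G) : g \notin torsion_part G ->
  exists f : hom G rat, f g != 0.
Proof.
move=> gT.
have gz c : g *~ c = 0 -> c = 0.
  move=> gc; apply/eqP; apply: contraNT gT => c0; exact: torsionPz gc.
have Ts : subgroup [set y | exists b, y = g *~ b]%classic.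
  split; first by exists 0; rewrite mulr0z.
  by move=> _ _ [a ->] [b ->]; exists (a - b); rewrite mulrzBr.
have Zs : subgroup [set (0 : G)]%classic by split=> // _ _ -> ->; rewrite subr0.
have [M [Ms _ TM maxM]] := maximal_avoiding Ts Zs.
have ex x : exists ab : int * int, ab.1 != 0 /\ M (x *~ ab.1 - g *~ ab.2).
  have [Mx|/maxM [t [a [[b tE] t0 Mta]]]] := pselect (M x).
    by exists (1, 0); rewrite mulr1z mulr0z subr0.
  exists (a, b) => /=; split; last by rewrite -tE -opprB; apply: subgroupN.
  apply/eqP => a0; apply: t0; apply: TM; first by exists b.
  by rewrite a0 mulr0z subr0 in Mta.
have [ab abP] := @boolp.choice _ _ _ ex.
pose f x : rat := (ab x).2%:~R / (ab x).1%:~R.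
have fE x a b : a != 0 -> M (x *~ a - g *~ b) -> f x = b%:~R / a%:~R.
  move=> a0 Mxab; have [c0 Mxcd] := abP x.
  set c := (ab x).1 in c0 Mxcd; set d := (ab x).2 in Mxcd.
  have /gz/eqP : g *~ (b * c - d * a) = 0.
    apply: TM; first by exists (b * c - d * a).
    have -> : g *~ (b * c - d * a) = (x *~ c - g *~ d) *~ a - (x *~ a - g *~ b) *~ c.
      rewrite !mulrzBl !mulrzBr -!mulrzA [a * c]mulrC opprB addrC.
      by rewrite [RHS]addrC addrA subrK addrC.
    by apply: Ms.2; apply: subgroupMz.
  rewrite subr_eq0 => /eqP bc; rewrite /f -/c -/d.
  apply/eqP; rewrite eqr_div ?intr_eq0 //.
  by rewrite -!intrM bc.
have fB : zmod_morphism f.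
  move=> x y; have [a0 Mx] := abP x; have [c0 My] := abP y.
  rewrite (fE (x - y) ((ab x).1 * (ab y).1) ((ab x).2 * (ab y).1 - (ab y).2 * (ab x).1)).
  - rewrite /f rmorphB /= !rmorphM /=; field.
    by rewrite !intr_eq0 a0 c0.
  - by rewrite mulf_neq0.
  set a := (ab x).1 in a0 Mx *; set b := (ab x).2 in Mx *.
  set c := (ab y).1 in c0 My *; set d := (ab y).2 in My *.
  have -> : (x - y) *~ (a * c) - g *~ (b * c - d * a)
      = (x *~ a - g *~ b) *~ c - (y *~ c - g *~ d) *~ a.
    rewrite !mulrzBl !mulrzBr -!mulrzA [c * a]mulrC !opprB addrACA.
    by rewrite [in RHS]addrACA [- (g *~ (b * c)) + _]addrC [X in _ + X]addrC.
  by apply: Ms.2; apply: subgroupMz.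
exists (mk_hom fB); rewrite mk_homE (fE g 1 1) ?divr1 //.
by rewrite subrr; case: Ms.
Qed.

(** A homomorphism f from G to Q with f(g) nonzero induces a map on the tensor product that does not
    kill the tensor of 1 and g. *)
Lemma tens1_eq0 (G : zmodType) (g : G) : tens (1 : rat) g = 0 -> g \in torsion_part G.
Proof.
move=> g0; apply: contraT => /hom_to_rat [f /eqP fg].
have phiD : biadditive (fun (q : rat) (x : G) => q * f x).
  by split=> [x q q'|q x x'] /=; rewrite ?mulrDl // raddfD mulrDr.
pose L := mk_hom (tensor_lift_is_zmod_morphism phiD).
have := raddf0 L; rewrite -g0 mk_homE (tensor_lift_tens phiD) mul1r.
by move/fg.
Qed.

Lemma common_denominator (I : finType) (u : I -> rat) :
  exists d : nat, (0 < d)%N /\ exists c : I -> int, forall i, u i * d%:R = (c i)%:~R.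
Proof.
have [d [d0 dP]] : exists d : nat, (0 < d)%N /\
    forall i, i \in enum I -> exists c : int, u i * d%:R = c%:~R.
  elim: (enum I) => [|i s [d [d0 dP]]]; first by exists 1%N.
  exists (d * `|denq (u i)|)%N; split; first by rewrite muln_gt0 d0 absz_gt0 denq_neq0.
  move=> j; rewrite inE => /predU1P [->|/dP [c cE]].
    exists (numq (u i) * d%:Z); rewrite natrM mulrA mulrAC [X in _ * X * _]pmulrn.
    by rewrite absz_denq -numqE rmorphM.
  by exists (c * `|denq (u i)|%N%:Z); rewrite natrM mulrA cE rmorphM.
exists d; split=> //.
have [c cP] := @boolp.choice _ _ _ (fun i => dP i (mem_enum _ i)).
by exists c.
Qed.

Section Combinations.
Variable G : zmodType.

Definition comb k (x : 'I_k -> G) (c : 'I_k -> int) := \sum_i x i *~ c i.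

Lemma combMz k (x : 'I_k -> G) c a : comb x (fun i => c i * a) = comb x c *~ a.
Proof.
by rewrite /comb mulrz_suml; apply: eq_bigr => i _; rewrite mulrzA.
Qed.

Definition extend k (x : 'I_k -> G) (h : G) (i : 'I_k.+1) :=
  if unlift ord0 i is Some j then x j else h.

Lemma comb_extend k (x : 'I_k -> G) h c :
  comb (extend x h) c = h *~ c ord0 + comb x (fun i => c (lift ord0 i)).
Proof.
rewrite /comb big_ord_recl /extend unlift_none; congr (_ + _).
by apply: eq_bigr => i _; rewrite liftK.
Qed.

Definition join k l (x : 'I_k -> G) (y : 'I_l -> G) (i : 'I_(k + l)) :=
  match fintype.split i with inl a => x a | inr b => y b end.

Lemma comb_join k l (x : 'I_k -> G) (y : 'I_l -> G) c d :
  comb (join x y) (fun i => match fintype.split i with inl a => c a | inr b => d b end)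
  = comb x c + comb y d.
Proof.
rewrite /comb big_split_ord /join; congr (_ + _); apply: eq_bigr => i _.
  by rewrite (unsplitK (inl i)).
by rewrite (unsplitK (inr i)).
Qed.

(** Bounding the rank by integer relations makes the passage to subgroups immediate. *)
Definition rank_le r := forall x : 'I_r.+1 -> G,
  exists c : 'I_r.+1 -> int, (exists i, c i != 0) /\ comb x c = 0.

Lemma torsion_free_rank_le r : torsion_free_rank G r -> rank_le r.
Proof.
move=> [b [_ spanb]] x.
have [A AP] := @boolp.choice _ _ _ (fun i => spanb (tens 1 (x i))).
pose M : 'M[rat]_(r.+1, r) := \matrix_(i, j) A i j.
have [u u0 uM] : exists2 u : 'rV[rat]_r.+1, u != 0 & u *m M = 0.
  have : kermx M != 0.
    rewrite -mxrank_eq0 mxrank_ker -lt0n subn_gt0.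
    by apply: leq_ltn_trans (rank_leq_col M) _.
  by case/rowV0Pn => u /sub_kermxP uM u0; exists u.
have [d [d0 [c cE]]] := common_denominator (fun i => u 0 i).
have tens1B : zmod_morphism (fun g : G => tens (1 : rat) g).
  have tens1D a a' : tens (1 : rat) (a + a' : G) = tens 1 a + tens 1 a' by exact: tensDr.
  move=> a a'; apply: (addIr (tens 1 a')); rewrite -tens1D !subrK //.
have scale_int (t : tensor rat G) (a : int) : t *~ a = (a%:~R : rat) *: t.
  by rewrite scaler_int.
have /tens1_eq0/torsionP [N N0 xN] : tens (1 : rat) (comb x c) = 0.
  rewrite -[LHS](mk_homE tens1B) raddf_sum.
  under eq_bigr => i _ do rewrite raddfMz mk_homE scale_int -cE mulrC -scalerA AP.
  rewrite -scaler_sumr.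
  under eq_bigr => i _ do rewrite scaler_sumr.
  rewrite exchange_big big1 ?scaler0 // => j _.
  under eq_bigr => i _ do rewrite scalerA.
  rewrite -scaler_suml.
  have /(congr1 (fun v : 'rV_r => v 0 j)) := uM.
  rewrite !mxE; under eq_bigr => i _ do rewrite mxE.
  by move=> ->; rewrite scale0r.
(* The relation c, obtained over Q, holds in G only up to torsion, which N kills. *)
exists (fun i => c i * N%:Z); split; last by rewrite combMz -pmulrn.
have [i ui] : exists i, u 0 i != 0.
  apply: contrapT => no; case/negP: u0; apply/eqP/rowP => i; rewrite mxE.
  by apply/eqP; apply: contrapT => /negP ui; apply: no; exists i.
exists i; rewrite mulf_neq0 //; last by rewrite eqz_nat -lt0n.
by rewrite -(intr_eq0 rat) -cE mulf_neq0 // pnatr_eq0 -lt0n.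
Qed.

(** [indep] is abstract because it serves both for independence over Q and for independence modulo
    q. *)
Lemma maximal_family r (indep : forall k, ('I_k -> G) -> Prop) :
  (forall x : 'I_0 -> G, indep 0%N x) -> (forall x, ~ indep r.+1 x) ->
  exists k (x : 'I_k -> G), indep k x /\ forall h, ~ indep k.+1 (extend x h).
Proof.
move=> ind0 indr; apply: contrapT => no.
have all k : exists x : 'I_k -> G, indep k x.
  elim: k => [|k [x indx]]; first by exists (fun=> 0).
  apply: contrapT => nk; apply: no; exists k, x; split=> // h indxh.
  by apply: nk; exists (extend x h).
by have [x /indr] := all r.+1.
Qed.

Lemma rational_generators r : rank_le r ->
  exists k (x : 'I_k -> G), forall h, exists (N : int) (c : _ -> int), N != 0 /\ h *~ N = comb x c.
Proof.
move=> rG.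
have [||k [x [indx maxx]]] := @maximal_family r
    (fun k x => forall c, comb x c = 0 -> forall i, c i = 0).
- by move=> x c _ [].
- by move=> x indx; have [c [[i /eqP ci] /indx/(_ i)]] := rG x.
exists k, x => h; apply: contrapT => no; apply: (maxx h) => c.
rewrite comb_extend => hc.
have c0 : c ord0 = 0.
  apply/eqP; apply: contrapT => /negP c0.
  apply: no; exists (c ord0), (fun i => - c (lift ord0 i)).
  split=> //; apply/eqP; rewrite -subr_eq0 -[X in _ - X](_ : - comb x (fun i => c (lift ord0 i)) = _).
    by rewrite opprK hc.
  by rewrite /comb -sumrN; apply: eq_bigr => i _; rewrite mulrNz.
move: hc; rewrite c0 mulr0z add0r => /indx cl i.
by case: (unliftP ord0 i) => [j|] ->.
Qed.

(** Modulo torsion, h is determined by N and c with N h = [comb x c] and N nonzero, and there are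
    countably many such codes. *)
Lemma countable_mod_torsion r : rank_le r ->
  exists e : nat -> G, forall h, exists j, h - e j \in torsion_part G.
Proof.
move=> /rational_generators [k [x xP]].
pose code : countType := (int * {ffun 'I_k -> int})%type.
pose P (w : code) h := w.1 != 0 /\ h *~ w.1 = comb x w.2.
have ex (j : nat) : exists h, forall w : code,
    choice.unpickle j = Some w -> (exists h, P w h) -> P w h.
  case: (choice.unpickle j) => [w|]; last by exists 0.
  have [[h Ph]|no] := pselect (exists h, P w h); first by exists h => _ [<-].
  by exists 0 => _ [<-] /no.
have [e eP] := @boolp.choice _ _ _ ex; exists e => h.
have [N [c [N0 hN]]] := xP h.
pose w : code := (N, [ffun i => c i]).
have Pwh : P w h.
  by split=> //=; rewrite hN; apply: eq_bigr => i _; rewrite ffunE.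
have [_ eN] := eP (choice.pickle w) w (choice.pickleK w) (ex_intro _ h Pwh).
exists (choice.pickle w); apply: (torsionPz N0).
by rewrite mulrzBl eN Pwh.2 subrr.
Qed.

(** A family independent modulo q has at most r members: in the absence of q-torsion, a nonzero
    integer relation could be divided by q forever. *)
Lemma generators_mod_prime r q : rank_le r -> prime q ->
  (forall y : G, y *+ q = 0 -> y = 0) ->
  exists k (x : 'I_k -> G), forall h, exists c g, h = comb x c + g *+ q.
Proof.
move=> rG qp qG.
have [||k [x [indx maxx]]] := @maximal_family r
    (fun k x => forall c, (exists g, comb x c = g *+ q) -> forall i, (q%:Z %| c i)%Z).
- by move=> x c _ [].
- move=> x indx; have [c [[i0 ci0] xc]] := rG x.
  have qm m d : comb x d = 0 -> forall i, ((q ^ m)%N%:Z %| d i)%Z.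
    elim: m d => [|m IHm] d xd i; first by rewrite dvd1z.
    have xd' : exists g, comb x d = g *+ q by exists 0; rewrite xd mul0rn.
    have [d' dE] := @boolp.choice _ _ _ (fun i => dvdzP (indx d xd' i)).
    have /IHm/(_ i) : comb x d' = 0.
      apply: qG; rewrite pmulrn -combMz -xd.
      by apply: eq_bigr => j _; rewrite -dE.
    by rewrite dE expnSr PoszM => ?; apply: dvdz_mul.
  have := qm `|c i0|%N c xc i0; rewrite dvdzE /= => /dvdn_leq.
  rewrite absz_gt0 ci0 => /(_ isT); rewrite leqNgt => /negP; apply.
  exact: ltn_expl (prime_gt1 qp).
exists k, x => h; apply: contrapT => no; apply: (maxx h) => c [g].
rewrite comb_extend => hc.
have qc0 : (q%:Z %| c ord0)%Z.
  apply: contrapT => /negP /(bezout_prime qp) [u [v uv]]; apply: no.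
  exists (fun i => c (lift ord0 i) * - u), (g *~ u + h *~ v).
  have -> : (g *~ u + h *~ v) *+ q = (g *+ q) *~ u + h *~ (v * q%:Z).
    by rewrite mulrnDl !pmulrn -!mulrzA [u * _]mulrC.
  rewrite -hc combMz mulrNz mulrzDl -mulrzA [_ + _ *~ u]addrC -!addrA addKr.
  by rewrite -mulrzDr [c _ * u]mulrC uv.
move=> i; case: (unliftP ord0 i) => [j|] -> //.
apply: (indx (fun i => c (lift ord0 i))); have /dvdzP [b cE] := qc0.
by exists (g - h *~ b); rewrite mulrnBl -hc cE mulrzA -pmulrn [RHS]addrC addKr.
Qed.


Lemma generators_mod r n : (0 < n)%N -> rank_le r ->
  (forall y : G, y *+ n = 0 -> y = 0) ->
  exists k (x : 'I_k -> G), forall h, exists c g, h = comb x c + g *+ n.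
Proof.
elim/ltn_ind: n => n IHn n0 rG nG.
have [n1|n1] := leqP n 1%N.
  exists 0%N, (fun=> 0) => h; exists (fun=> 0), h.
  have -> : n = 1%N by lia.
  by rewrite /comb big_ord0 add0r.
have qp := pdiv_prime n1; set q := pdiv n in qp.
have [m nE] : exists m, n = (m * q)%N by apply/dvdnP/pdiv_dvd.
have m0 : (0 < m)%N by move: n0; rewrite nE muln_gt0 => /andP [].
have mn : (m < n)%N by rewrite nE -[ltnLHS]muln1 ltn_pmul2l // prime_gt1.
have [|k [x xP]] := IHn m mn m0 rG.
  by move=> y ym; apply: nG; rewrite nE mulrnA ym mul0rn.
have [|l [y yP]] := generators_mod_prime rG qp.
  by move=> y yq; apply: nG; rewrite nE mulnC mulrnA yq mul0rn.
exists (k + l)%N, (join x (fun i => y i *+ m)) => h.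
have [c [g hE]] := xP h; have [d [g' gE]] := yP g.
exists (fun i => match fintype.split i with inl a => c a | inr b => d b end), g'.
rewrite comb_join hE {1}gE mulrnDl addrA nE [(m * q)%N]mulnC mulrnA.
congr (_ + _ + _); rewrite /comb -sumrMnl; apply: eq_bigr => i _.
by rewrite !pmulrn -!mulrzA mulrC.
Qed.

End Combinations.

Lemma rank_le_inj (G H : zmodType) (i : hom H G) r :
  injective i -> rank_le G r -> rank_le H r.
Proof.
move=> ij rG x; have [c [c0 xc]] := rG (i \o x); exists c; split=> //.
apply: ij; rewrite raddf0 -[RHS]xc /comb raddf_sum.
by apply: eq_bigr => j _; rewrite raddfMz.
Qed.

Lemma free_row (k : nat) : free_group 'rV[int]_k.
Proof.
exists ('I_k : Type).
have fin (u : 'I_k -> int) : u \in @finite_supp 'I_k int.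
  by apply/finite_suppP; apply: finite_finset.
apply: (@zmod_iso_can 'rV[int]_k (dsum 'I_k int)
  (fun u => Dsum (fin (fun i => u 0 i))) (fun f => \row_i f i)).
- by move=> u v; apply: dsumP => i; rewrite /= !mxE.
- by move=> u; apply/rowP => i; rewrite mxE.
- by move=> f; apply: dsumP => i; rewrite /= mxE.
Qed.

(** A nonzero value of least absolute value generates the image of f, so f can be divided by it. *)
Lemma nonzero_hom_int (H : zmodType) (f : hom H int) : (exists h, f h != 0) ->
  exists (g : hom H int) (h : H), g h = 1.
Proof.
move=> [h1 fh1].
pose P d := (0 < d)%N && `[< exists h, `|f h|%N = d >].
have exP : exists d, P d.
  by exists `|f h1|%N; rewrite /P absz_gt0 fh1; apply/asboolP; exists h1.
case: (ex_minnP exP) => d /andP [d0 /asboolP [h fhd]]; rewrite -fhd in d0 * => mind.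
have {}d0 : f h != 0 by rewrite -absz_gt0.
have fdiv y : exists a, f y = a * f h.
  apply/dvdzP/dvdz_mod0P/eqP; rewrite -absz_eq0 -leqn0 leqNgt; apply/negP => r0.
  have : P `|(f y %% f h)%Z|%N.
    rewrite /P r0; apply/asboolP; exists (y - h *~ (f y %/ f h)%Z).
    by rewrite raddfB raddfMz /modz -mulrzr intz mulrC.
  move/mind; rewrite leqNgt => /negP; apply.
  by rewrite -ltz_nat gez0_abs ?modz_ge0 // ltz_mod.
have [g gP] := @boolp.choice _ _ _ fdiv.
have gB : zmod_morphism g.
  by move=> x y; apply: (mulIf d0); rewrite mulrBl -!gP raddfB.
exists (mk_hom gB), h; apply: (mulIf d0).
by rewrite mk_homE -gP mul1r.
Qed.

(** The rank bounds k. A nonzero homomorphism H -> Z would yield a surjective one, and another copy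
    of Z would split off. *)
Lemma free_part (G : zmodType) r : rank_le G r ->
  exists k (H : zmodType) (i : hom H G) (p : hom G H),
    [/\ cancel i p, zmod_iso G ('rV[int]_k * H)%type
      & forall (f : hom H int) h, f h = 0].
Proof.
move=> rG.
pose S k := exists (s : hom 'rV[int]_k G) (t : hom G 'rV[int]_k), cancel s t.
have nS : ~ S r.+1.
  move=> [s [t stK]].
  have [c [[i ci] xc]] := rG (fun i => s (delta_mx 0 i)).
  have : s (\row_i c i) = 0.
    rewrite -xc [\row_i c i]row_sum_delta raddf_sum; apply: eq_bigr => j _.
    by rewrite mxE -raddfMz -[c j in LHS]intz scaler_int.
  move/(congr1 t); rewrite stK raddf0 => /rowP /(_ i); rewrite !mxE => ci0.
  by rewrite ci0 eqxx in ci.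
have [k [s [t stK]] nSk] : exists2 k, S k & ~ S k.+1.
  apply: contrapT => no; apply: nS; elim: r.+1 => [|k Sk]; last first.
    by apply: contrapT => nk; apply: no; exists k.
  by exists 0, 0 => u; apply/rowP => -[].
have qP : zmod_morphism (fun x => x - s (t x)).
  by move=> x y; rewrite !raddfB /= addrACA.
have [x|H [i [p [ipK ip]]]] := @idem_retract G (mk_hom qP).
  have tq : t (x - s (t x)) = 0 by rewrite raddfB stK subrr.
  by rewrite !mk_homE tq raddf0 subr0.
have {}ip x : i (p x) = x - s (t x) by rewrite ip.
have ti h : t (i h) = 0.
  apply: (can_inj stK); rewrite raddf0; apply/eqP; rewrite -oppr_eq0.
  by rewrite -(inj_eq (addrI (i h))) -ip ipK addr0.
have ps u : p (s u) = 0 by apply: (can_inj ipK); rewrite ip stK subrr raddf0.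
exists k, H, i, p; split=> //.
  apply: (@zmod_iso_can G ('rV[int]_k * H)%type (fun x => (t x, p x))
    (fun y => s y.1 + i y.2)).
  - by move=> x y; rewrite !raddfB.
  - by move=> x; rewrite /= ip addrC subrK.
  - by move=> [u h]; rewrite /= !raddfD /= stK ti ps ipK addr0 add0r.
move=> f h; apply/eqP; apply: contrapT => /negP fh; apply: nSk.
have [|g [h0 gh0]] := @nonzero_hom_int H f; first by exists h.
have s'P : zmod_morphism (fun u : 'rV[int]_(1 + k) => s (rsubmx u) + i h0 *~ u 0 0).
  by move=> u v; rewrite !mxE mulrzBr !raddfB /= addrACA opprD.
have t'P : zmod_morphism (fun x => row_mx (\row_(_ < 1) g (p x)) (t x) : 'rV_(1 + k)).
  move=> x y; rewrite -[RHS]/(row_mx _ _ + - row_mx _ _) opp_row_mx add_row_mx !raddfB.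
  by congr row_mx; apply/rowP => j; rewrite !mxE.
exists (mk_hom s'P), (mk_hom t'P) => u; rewrite !mk_homE.
move: (u : 'rV[int]_(1 + k)) => {}u.
have pE : p (s (rsubmx u) + i h0 *~ u 0 0) = h0 *~ u 0 0.
  by rewrite raddfD ps add0r raddfMz ipK.
have tE : t (s (rsubmx u) + i h0 *~ u 0 0) = rsubmx u.
  by rewrite raddfD stK raddfMz ti mul0rz addr0.
rewrite pE tE raddfMz gh0.
refine (etrans (congr2 (@row_mx int 1 1 k) _ erefl) (@hsubmxK int 1 1 k u)).
apply/rowP => j.
by rewrite !mxE intz ord1; congr (u _ _); apply: val_inj.
Qed.

(** * Generic lattices *)

Section Congruence.
Variables (n k : nat).
Implicit Types D : 'rV[int]_k.

Definition cong m D D' := exists d, D' = D + (n ^ m)%N%:Z *: d.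

Lemma cong_refl m D : cong m D D.
Proof. by exists 0; rewrite scaler0 addr0. Qed.

Lemma cong_trans m D D' D'' : cong m D D' -> cong m D' D'' -> cong m D D''.
Proof. by move=> [d ->] [e ->]; exists (d + e); rewrite scalerDr addrA. Qed.

Lemma cong_le m m' D D' : (m <= m')%N -> cong m' D D' -> cong m D D'.
Proof.
move=> mm' [d ->]; exists ((n ^ (m' - m))%N%:Z *: d).
by rewrite scalerA -PoszM -expnD subnKC.
Qed.

Lemma cong_chain (D_ : nat -> 'rV[int]_k) : (forall m, cong m (D_ m) (D_ m.+1)) ->
  forall m m', (m <= m')%N -> cong m (D_ m) (D_ m').
Proof.
move=> DD m m' /subnK <-; elim: (m' - m)%N => [|i IHi]; first exact: cong_refl.
by apply: cong_trans IHi _; rewrite addSn; apply: cong_le (DD _); apply: leq_addl.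
Qed.

(** A Baire category argument in Z_n^k: every ball contains a smaller one on which condition j
    holds, and the conditions are met in turn along nested balls. W holds witnesses, which may
    depend on the ball. *)
Lemma generic_sequence (J : countType) (W : Type) (Q : J -> W -> nat -> 'rV[int]_k -> Prop) :
  (forall j m D, exists w m' D', [/\ (m <= m')%N, cong m D D' &
     forall m'' D'', (m' <= m'')%N -> cong m' D' D'' -> Q j w m'' D'']) ->
  exists D_ : nat -> 'rV[int]_k, (forall m, cong m (D_ m) (D_ m.+1)) /\
    forall j, exists w M, forall m, (M <= m)%N -> Q j w m (D_ m).
Proof.
move=> dense.
pose next (i : nat) (s t : nat * 'rV[int]_k) := [/\ (s.1 < t.1)%N, cong s.1 s.2 t.2 &
  forall j, choice.unpickle i = Some j ->
    exists w, forall m D, (t.1 <= m)%N -> cong t.1 t.2 D -> Q j w m D].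
have ex (is' : nat * (nat * 'rV[int]_k)) : exists t, next is'.1 is'.2 t.
  case: is' => i [m D] /=; rewrite /next; case: (choice.unpickle i) => [j|]; last first.
    by exists (m.+1, D); split=> //; apply: cong_refl.
  have [w [m' [D' [mm' DD' Qj]]]] := dense j m D.
  exists (m'.+1, D'); split=> //= _ [<-]; exists w => m'' D'' mm'' DD''.
  by apply: Qj; [apply: ltnW | apply: cong_le DD''].
have [nx nxP] := @boolp.choice _ _ _ ex.
pose st := fix st i := if i is i'.+1 then nx (i', st i') else (0%N, 0 : 'rV[int]_k).
have stP i : next i (st i) (st i.+1) by exact: (nxP (i, st i)).
have sti i : (i <= (st i).1)%N.
  by elim: i => // i IHi; case: (stP i) => lt _ _; apply: leq_ltn_trans lt.
have stm i i' : (i <= i')%N -> ((st i).1 <= (st i').1)%N.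
  move=> /subnK <-; elim: (i' - i)%N => // l IHl.
  by case: (stP (l + i)%N) => lt _ _; apply: leq_trans IHl (ltnW lt).
have stc i i' : (i <= i')%N -> cong (st i).1 (st i).2 (st i').2.
  move=> /subnK <-; elim: (i' - i)%N => [|l IHl]; first exact: cong_refl.
  case: (stP (l + i)%N) => _ c _; apply: cong_trans IHl _.
  by apply: cong_le c; apply/stm/leq_addl.
exists (fun i => (st i).2); split=> [m|j].
  by case: (stP m) => _ c _; apply: cong_le c.
case: (stP (choice.pickle j)) => _ _ /(_ j (choice.pickleK j)) [w wP].
exists w, (maxn (choice.pickle j).+1 (st (choice.pickle j).+1).1) => m.
by rewrite geq_max => /andP [jm stjm]; apply: wP => //; apply: stc.
Qed.

End Congruence.

Section Lattices.
Variables (n k : nat) (n_gt1 : (1 < n)%N).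
Implicit Types D z : 'rV[int]_k.

Definition Qvect : zmodType := (rat * 'rV[rat]_k)%type.
Implicit Types c : Qvect.

Let n_neq0 m : (n ^ m)%N%:R != 0 :> rat.
Proof. by rewrite pnatr_eq0 -lt0n expn_gt0 (ltnW n_gt1). Qed.

Lemma Qvect_fstMz c a : (c *~ a).1 = c.1 * a%:~R.
Proof.
by rewrite mulrzr; exact: (raddfMz (GRing.Additive.clone _ _ (@fst rat 'rV[rat]_k) _)).
Qed.

Lemma Qvect_sndMz c a : (c *~ a).2 = a%:~R *: c.2.
Proof.
by rewrite scaler_int; exact: (raddfMz (GRing.Additive.clone _ _ (@snd rat 'rV[rat]_k) _)).
Qed.

Lemma Qvect_torsion_free c a : a != 0 -> c *~ a = 0 -> c = 0.
Proof.
move=> a0 ca; have := Qvect_fstMz c a; have := Qvect_sndMz c a; rewrite ca.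
move=> /esym/eqP; rewrite scaler_eq0 intr_eq0 (negPf a0) => /eqP c2.
move=> /esym/eqP; rewrite mulf_eq0 intr_eq0 (negPf a0) orbF => /eqP c1.
by case: c c1 c2 {ca} => u v /= -> ->.
Qed.

Definition iv z : 'rV[rat]_k := map_mx intr z.

Lemma ivB y z : iv (y - z) = iv y - iv z. Proof. exact: map_mxB. Qed.
Lemma ivD y z : iv (y + z) = iv y + iv z. Proof. exact: map_mxD. Qed.
Lemma ivZ a z : iv (a *: z) = a%:~R *: iv z. Proof. exact: map_mxZ. Qed.
Lemma iv_inj : injective iv.
Proof.
move=> y z /rowP yz; apply/rowP => i; have := yz i; rewrite !mxE.
by move=> /eqP; rewrite eqr_int => /eqP.
Qed.

(* The lattice [lat m D] has the basis [pt m D 1 0 = (1, - D) / n ^ m] and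
   [pt m D 0 e_i = (0, e_i)]. *)
Definition pt m D (a : int) z : Qvect :=
  (a%:~R / (n ^ m)%N%:R, iv z - (a%:~R / (n ^ m)%N%:R) *: iv D).

Definition lat m D c := exists a z, c = pt m D a z.

Lemma ptB m D a b y z : pt m D (a - b) (y - z) = pt m D a y - pt m D b z.
Proof.
rewrite /pt -[RHS]/(_ - _, _ - _); congr pair; first by rewrite rmorphB mulrBl.
rewrite rmorphB mulrBl ivB scalerBl !opprB addrACA [in RHS]addrACA.
by rewrite [- iv z - _]addrC.
Qed.

Lemma pt_inj m D a b y z : pt m D a y = pt m D b z -> a = b /\ y = z.
Proof.
move=> [/(mulIf (invr_neq0 (n_neq0 m)))/eqP]; rewrite eqr_int => /eqP <- /addIr/iv_inj.
by [].
Qed.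

Lemma pt00 m D : pt m D 0 0 = 0.
Proof. by have := ptB m D 0 0 0 0; rewrite !subrr. Qed.

Lemma lat_subgroup m D : subgroup (lat m D).
Proof.
split; first by exists 0, 0; rewrite pt00.
by move=> _ _ [a [y ->]] [b [z ->]]; exists (a - b), (y - z); rewrite ptB.
Qed.

(** With D' = D + n^m d one has (1, -D) / n^m = n^j (1, -D') / n^(m+j) + (0, d), so coherent
    approximations give ascending lattices. *)
Lemma pt_cong m j D d a z :
  pt m D a z = pt (m + j) (D + (n ^ m)%N%:Z *: d) (a * (n ^ j)%N%:Z) (z + a *: d).
Proof.
rewrite /pt; have e : (a * (n ^ j)%N%:Z)%:~R / (n ^ (m + j))%N%:R = a%:~R / (n ^ m)%N%:R :> rat.
  rewrite expnD natrM rmorphM /= -[(Posz _)%:~R]/((n ^ j)%N%:R : rat).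
  by field; rewrite !n_neq0.
congr pair; rewrite e // !ivD !ivZ scalerDr scalerA -[(Posz _)%:~R]/((n ^ m)%N%:R : rat).
by rewrite divfK // opprD addrACA subrr addr0.
Qed.

Lemma lat_cong m m' D D' c : (m <= m')%N -> cong n m D D' -> lat m D c -> lat m' D' c.
Proof.
move=> /subnKC <- [d ->] [a [z ->]].
by rewrite (pt_cong m (m' - m) D d); eexists; eexists.
Qed.

Lemma latP m D c : lat m D c <->
  (exists a : int, c.1 * (n ^ m)%N%:R = a%:~R) /\ exists z, c.2 + c.1 *: iv D = iv z.
Proof.
split=> [[a [z ->]]|[[a ca] [z cz]]].
  by split; [exists a; rewrite /= divfK | exists z; rewrite /= subrK].
have c1 : c.1 = a%:~R / (n ^ m)%N%:R by rewrite -ca mulfK.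
by exists a, z; rewrite /pt -c1 -cz addrK; case: (c).
Qed.

End Lattices.

Lemma scale_int_eq0 k N (x : 'rV[int]_k) : N != 0 -> N *: x = 0 -> x = 0.
Proof.
move=> N0 /rowP e; apply/rowP => i; have := e i; rewrite !mxE => /eqP.
by rewrite mulf_eq0 (negPf N0) => /eqP.
Qed.

Section EigenvectorDefect.
Variables (k : nat) (P : int) (p : 'rV[int]_k) (Q : 'cV[int]_k) (R : 'M[int]_k).

(* For the linear map A of Q x Q^k with rows (P, p) and (Q_i, R_i), the vector
   (1, - D) is mapped to s (1, - D) + (0, defect D), with s = P - D Q. *)
Definition defect (D : 'rV[int]_k) : 'rV[int]_k :=
  p - D *m R + (P - (D *m Q) 0 0) *: D.

Lemma defect_shift D N d : defect (D + N *: d) = defect D + N *: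
  ((P - (D *m Q) 0 0) *: d - d *m R - (d *m Q) 0 0 *: (D + N *: d)).
Proof.
rewrite /defect !mulmxDl -!scalemxAl.
move: (D *m R) (d *m R) (D *m Q) (d *m Q) => r r' s s'.
by apply/rowP => i; rewrite !mxE; ring.
Qed.

Lemma defect_cong n m D D' : cong n m D D' -> cong n m (defect D) (defect D').
Proof. by move=> [d ->]; rewrite defect_shift; eexists. Qed.

(** [defect] is quadratic in D, and vanishing on a whole residue class kills its coefficients. *)
Lemma defect_eq0 N D : N != 0 -> (forall d, defect (D + N *: d) = 0) ->
  [/\ Q = 0, p = 0 & R = P%:M].
Proof.
move=> N0 E0; have D0 : defect D = 0 by have := E0 0; rewrite scaler0 addr0.
have {}E0 d : (P - (D *m Q) 0 0) *: d - d *m R - (d *m Q) 0 0 *: (D + N *: d) = 0.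
  have := E0 d; rewrite defect_shift D0.
  by rewrite add0r; apply: scale_int_eq0.
have Q0 : Q = 0.
  apply/colP => i; rewrite [RHS]mxE.
  (* Opposite values of d isolate the quadratic term, which contains Q alone. *)
  have := congr1 (fun v : 'rV_k => v 0 i) (E0 (delta_mx 0 i)).
  have := congr1 (fun v : 'rV_k => v 0 i) (E0 (- delta_mx 0 i)).
  rewrite !mulNmx -!rowE !mxE !eqxx /= => e1 e2.
  have /eqP : 2 * N * Q i 0 = 0 by lra.
  by rewrite mulf_eq0 mulf_eq0 (negPf N0) => /eqP.
have R0 : R = P%:M.
  apply/row_matrixP => i; have := E0 (delta_mx 0 i).
  rewrite Q0 !mulmx0 !mxE scale0r !subr0 => /eqP; rewrite subr_eq0 => /eqP.
  by rewrite -rowE => <-; rewrite rowE mul_mx_scalar.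
split=> //; move: D0.
by rewrite /defect Q0 R0 mulmx0 mul_mx_scalar !mxE subr0 subrK.
Qed.

End EigenvectorDefect.

(** * Excluding homomorphisms by refining an n-adic approximation *)

Section GenericGroup.
Variables (n k : nat) (n_gt1 : (1 < n)%N) (H : zmodType).
Hypothesis H_tf : forall y : H, y *+ n = 0 -> y = 0.
Implicit Types (D : 'rV[int]_k) (h : 'I_k -> H).

(** The order of t is coprime to n, so n^m acts invertibly on the cyclic group of t. *)
Lemma torsion_divisible (t : H) m : t \in torsion_part H -> exists y, t = y *+ n ^ m.
Proof.
move=> /torsionP ex.
have exP : exists N, (0 < N)%N && (t *+ N == 0).
  by case: ex => N N0 /eqP tN; exists N; rewrite N0.
case: (ex_minnP exP) => N /andP [N0 /eqP tN] minN.
have cop : coprime N (n ^ m).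
  apply/coprimeXr; rewrite /coprime eqn_leq gcdn_gt0 N0 andbT leqNgt; apply/negP => e1.
  set e := gcdn N n in e1.
  have [N' NE] : exists N', N = (N' * e)%N by apply/dvdnP/dvdn_gcdl.
  have [n' nE] : exists n', n = (n' * e)%N by apply/dvdnP/dvdn_gcdr.
  have N'0 : (0 < N')%N by move: N0; rewrite NE muln_gt0 => /andP [].
  have : t *+ N' = 0.
    by apply: H_tf; rewrite -mulrnA nE mulnCA -NE mulnC mulrnA tN mul0rn.
  move=> tN'; have /minN : (0 < N')%N && (t *+ N' == 0) by rewrite N'0 tN' eqxx.
  by rewrite NE leqNgt -[ltnLHS]muln1 ltn_pmul2l // e1.
have [u [v uv]] := Bezoutz N%:Z (n ^ m)%N%:Z.
exists (t *~ v); rewrite pmulrn -mulrzA -[in LHS](mulr1z t).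
have -> : 1 = u * N%:Z + v * (n ^ m)%N%:Z by rewrite uv /gcdz /= (eqP cop).
have tNz : t *~ N%:Z = 0 by rewrite -pmulrn.
by rewrite mulrzDr [u * _]mulrC !mulrzA tNz mul0rz add0r.
Qed.

Lemma exp_tf m (y : H) : y *+ n ^ m = 0 -> y = 0.
Proof.
elim: m y => [|m IHm] y; first by rewrite mulr1n.
by rewrite expnS mulrnA => /IHm /H_tf.
Qed.

Definition divisible_by m (x : H) := exists y, x = y *+ n ^ m.

Lemma divisible_by_subgroup m : subgroup [set x | divisible_by m x]%classic.
Proof.
split; first by exists 0; rewrite mul0rn.
by move=> _ _ [y ->] [z ->]; exists (y - z); rewrite mulrnBl.
Qed.

Lemma divisible_by_le m m' x : (m <= m')%N -> divisible_by m' x -> divisible_by m x.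
Proof.
by move=> mm' [y ->]; exists (y *+ n ^ (m' - m)); rewrite -mulrnA -expnD subnK.
Qed.

Lemma combDZ h D a d : comb h ((D + a *: d) 0) = comb h (D 0) + comb h (d 0) *~ a.
Proof.
rewrite /comb mulrz_suml -big_split; apply: eq_bigr => i _.
by rewrite !mxE mulrzDr mulrC mulrzA.
Qed.

Lemma comb_delta h i : comb h ((delta_mx 0 i : 'rV[int]_k) 0) = h i.
Proof.
rewrite /comb (bigD1 i) //= mxE !eqxx mulr1z big1 ?addr0 // => j ji.
by rewrite mxE (negPf ji) andbF mulr0z.
Qed.

Lemma comb_torsion h h' D : (forall i, h i - h' i \in torsion_part H) ->
  comb h (D 0) - comb h' (D 0) \in torsion_part H.
Proof.
move=> hh'; rewrite /comb -sumrB; apply: rpred_sum => i _.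
by rewrite -mulrzBl; apply: rpredMz.
Qed.

(** A homomorphism C -> H with values [h i] at the unit vectors and g at (1, 0) makes g - [comb h D]
    divisible by n^m at each precision m. If [h i] is not in n^2 H, then D and D + n^m e_i cannot
    both pass this test for n^(m+2), as their difference is n^m [h i]. *)
Lemma avoid_homs_from (h : 'I_k -> H) (g : H) i m D : ~ divisible_by 2 (h i) ->
  exists m' D', [/\ (m <= m')%N, cong n m D D' &
    forall m'' D'', (m' <= m'')%N -> cong n m' D' D'' ->
    forall h' g', (forall i, h' i - h i \in torsion_part H) ->
      g' - g \in torsion_part H -> ~ divisible_by m'' (g' - comb h' (D'' 0))].
Proof.
move=> hi; have divs := divisible_by_subgroup (m + 2).
have [D' DD' nD'] : exists2 D', cong n m D D' & ~ divisible_by (m + 2) (g - comb h (D' 0)).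
  apply: contrapT => no; apply: hi.
  have all D' : cong n m D D' -> divisible_by (m + 2) (g - comb h (D' 0)).
    by move=> DD'; apply: contrapT => nD'; apply: no; exists D'.
  have d0 := all D (cong_refl _ _ _).
  have d1 := all (D + (n ^ m)%N%:Z *: delta_mx 0 i) (ex_intro _ (delta_mx 0 i) erefl).
  have [y] := divs.2 _ _ d0 d1.
  rewrite combDZ comb_delta opprB addrC addrA subrK addrC addKr -pmulrn => yE.
  exists y; apply/eqP; rewrite -subr_eq0; apply/eqP/(@exp_tf m).
  by rewrite mulrnBl yE -mulrnA -expnD addnC subrr.
exists (m + 2)%N, D'; split=> [||m'' D'' mm'' [d ->] h' g' hh' gg' div]; rewrite ?leq_addr //.
apply: nD'; have {}div := divisible_by_le mm'' div.
rewrite combDZ in div.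
have tD := torsion_divisible (m + 2) (comb_torsion D' hh').
have tg := torsion_divisible (m + 2) gg'.
have dd : divisible_by (m + 2) (comb h' (d 0) *~ (n ^ (m + 2))%N%:Z) by eexists; rewrite -pmulrn.
have -> : g - comb h (D' 0) = (g' - (comb h' (D' 0) + comb h' (d 0) *~ (n ^ (m + 2))%N%:Z))
   - (g' - g) + (comb h' (D' 0) - comb h (D' 0)) + (comb h' (d 0) *~ (n ^ (m + 2))%N%:Z).
  rewrite opprB [X in X + _ + _]addrC subrKA opprD -!addrA.
  by rewrite [- comb h (D' 0) + _]addrC [comb h' (D' 0) + (_ + _)]addrCA !addKr.
by apply: subgroupD => //; apply: subgroupD => //; apply: divs.2.
Qed.

(** The lattice at precision m is free, so Hom(H, Z) = 0 provides a value c of f outside it; D is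
    then refined so that c stays outside all later lattices. *)
Lemma avoid_homs_to_lattices (f : hom H (Qvect k)) m D :
  (exists x, f x != 0) -> (forall (g : hom H int) x, g x = 0) -> (0 < k)%N ->
  exists x m' D', [/\ (m <= m')%N, cong n m D D' &
    forall m'' D'', (m' <= m'')%N -> cong n m' D' D'' -> ~ lat n m'' D'' (f x)].
Proof.
move=> f0 HZ k0.
have [h nlat] : exists x, ~ lat n m D (f x).
  apply: contrapT => no.
  have lath (h : H) : lat n m D (f h) by apply: contrapT => nl; apply: no; exists h.
  have [a aP] := @boolp.choice _ _ _ lath.
  have [z zP] := @boolp.choice _ _ _ aP.
  have azB x y : a (x - y) = a x - a y /\ z (x - y) = z x - z y.
    by apply: (pt_inj n_gt1 (m := m) (D := D)); rewrite -zP raddfB !zP ptB.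
  have aB : zmod_morphism a by move=> x y; case: (azB x y).
  have zB i : zmod_morphism (fun x => z x 0 i).
    by move=> x y; case: (azB x y) => _ ->; rewrite !mxE.
  case: f0 => h /eqP; apply; rewrite zP.
  have -> : a h = 0 by exact: (HZ (mk_hom aB)).
  have -> : z h = 0 by apply/rowP => i; rewrite [RHS]mxE; exact: (HZ (mk_hom (zB i))).
  exact: pt00.
exists h; set c := f h in nlat *.
have [[M [a ca]]|noM] := pselect (exists M (a : int), c.1 * (n ^ M)%N%:R = a%:~R); last first.
  exists m, D; split=> //; first exact: cong_refl.
  by move=> m'' D'' _ _ /(latP n_gt1) [ca _]; apply: noM; exists m''.
(* If both D and D + n^m e made this vector integral, then c.1 n^m would be an integer and c would
   already lie in [lat n m D]. *)
have [D' DD' nD'] : exists2 D', cong n m D D' & ~ exists z, c.2 + c.1 *: iv D' = iv z.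
  have [[z cz]|nz] := pselect (exists z, c.2 + c.1 *: iv D = iv z); last first.
    by exists D => //; apply: cong_refl.
  pose e : 'rV[int]_k := delta_mx 0 (Ordinal k0).
  exists (D + (n ^ m)%N%:Z *: e); first by exists e.
  move=> [z' cz']; apply: nlat; apply/(latP n_gt1); split; last by exists z.
  exists ((z' - z) 0 (Ordinal k0)).
  have /rowP/(_ (Ordinal k0)) : c.1 *: iv ((n ^ m)%N%:Z *: e) = iv (z' - z).
    by rewrite ivB -cz -cz' ivD scalerDr addrA [RHS]addrC addKr.
  by rewrite !mxE !eqxx mulr1.
(* Since c.1 n^M is an integer, changes of D beyond this precision alter c.1 D only by integer
   vectors. *)
exists (M + m)%N, D'; split=> //; first exact: leq_addl.
move=> m'' D'' _ [d ->] /(latP n_gt1) [_ [z cz]]; apply: nD'.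
exists (z - (a * (n ^ m)%N%:Z) *: d).
rewrite ivB -cz ivD ivZ scalerDr addrA ivZ scalerA.
have -> : c.1 * (n ^ (M + m))%N%:~R = (a * (n ^ m)%N%:Z)%:~R.
  by rewrite rmorphM /= -ca expnD PoszM rmorphM mulrA.
by rewrite addrK.
Qed.

Lemma avoid_homs_between_lattices (P : int) (p : 'rV_k) (Q : 'cV_k) (R : 'M_k) m D :
  ~ [/\ Q = 0, p = 0 & R = P%:M] ->
  exists m' D', [/\ (m <= m')%N, cong n m D D' &
    forall m'' D'', (m' <= m'')%N -> cong n m' D' D'' ->
    ~ exists z, defect P p Q R D'' = (n ^ m'')%N%:Z *: z].
Proof.
move=> nsc.
have [d Ed] : exists d, defect P p Q R (D + (n ^ m)%N%:Z *: d) != 0.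
  apply: contrapT => no; apply: nsc; apply: (@defect_eq0 k P p Q R (n ^ m)%N%:Z D).
    by rewrite eqz_nat -lt0n expn_gt0 (ltnW n_gt1).
  by move=> d; apply/eqP; apply: contrapT => /negP Ed; apply: no; exists d.
set D' := D + _ in Ed.
have [i Ei] : exists i, defect P p Q R D' 0 i != 0.
  apply: contrapT => no; case/negP: Ed; apply/eqP/rowP => i; rewrite [RHS]mxE.
  by apply/eqP; apply: contrapT => /negP Ei; apply: no; exists i.
(* A nonzero entry of absolute value x is not divisible by n^x, because x < n^x. *)
pose m' := maxn m (absz (defect P p Q R D' 0 i)).
exists m', D'; split; [exact: leq_maxl | by exists d |].
move=> m'' D'' mm'' DD'' [z Ez].
have [d' Ed'] := defect_cong P p Q R DD''.
have : ((n ^ m')%N%:Z %| (defect P p Q R D' 0 i)%R)%Z.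
  have -> : defect P p Q R D' = (n ^ m'')%N%:Z *: z - (n ^ m')%N%:Z *: d'.
    by rewrite -Ez Ed' addrK.
  rewrite !mxE; apply: rpredB; apply: dvdz_mulr => //.
  by rewrite dvdzE /= dvdn_exp2l.
rewrite dvdzE /= => /dvdn_leq; rewrite absz_gt0 Ei => /(_ isT).
rewrite leqNgt => /negP; apply; apply: leq_ltn_trans (leq_maxr m _) _.
exact: ltn_expl.
Qed.

End GenericGroup.

Lemma generic_lattices (n k r : nat) (H : zmodType) : (1 < n)%N -> (0 < k)%N ->
  rank_le H r -> (forall y : H, y *+ n = 0 -> y = 0) ->
  (forall (g : hom H int) x, g x = 0) ->
  exists D_ : nat -> 'rV[int]_k, [/\ forall m, cong n m (D_ m) (D_ m.+1),
    forall (h : 'I_k -> H) g, (forall m, divisible_by n m (g - comb h (D_ m 0))) ->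
      forall i, divisible_by n 2 (h i),
    forall f : hom H (Qvect k), (forall x, exists m, lat n m (D_ m) (f x)) ->
      forall x, f x = 0
    & forall P p Q R, (forall m, exists z, defect P p Q R (D_ m) = (n ^ m)%N%:Z *: z) ->
      [/\ Q = 0, p = 0 & R = P%:M]].
Proof.
move=> n1 k0 rH H_tf HZ.
have [e eP] := countable_mod_torsion rH.
have [l [b bP]] := rational_generators rH.
(* Countable codes: classes modulo torsion of the values for C -> H, values on rational generators
   for H -> C, integer matrices for C -> C. *)
pose J1 : countType := ({ffun 'I_k -> nat} * nat * 'I_k)%type.
pose J2 : countType := {ffun 'I_l -> rat * 'rV[rat]_k}.
pose J3 : countType := (int * 'rV[int]_k * 'cV[int]_k * 'M[int]_k)%type.
pose Q1 (j : J1) m (D : 'rV[int]_k) := let: (a, c, i) := j in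
  ~ divisible_by n 2 (e (a i)) ->
  forall h g, (forall i, h i - e (a i) \in torsion_part H) ->
    g - e c \in torsion_part H -> ~ divisible_by n m (g - comb h (D 0)).
pose Q2 (j : J2) (x : H) m (D : 'rV[int]_k) :=
  forall f : hom H (Qvect k), (forall i, f (b i) = j i) -> (exists x, f x != 0) ->
    ~ lat n m D (f x).
pose Q3 (j : J3) m (D : 'rV[int]_k) := let: (P, p, Q, R) := j in
  ~ [/\ Q = 0, p = 0 & R = P%:M] ->
  ~ exists z, defect P p Q R D = (n ^ m)%N%:Z *: z.
(* Only [Q2] uses the witness x, an element whose image avoids the later lattices; the other
   conditions receive the dummy 0. *)
pose QJ (j : J1 + J2 + J3) (x : H) m D :=
  match j with inl (inl j) => Q1 j m D | inl (inr j) => Q2 j x m D | inr j => Q3 j m D end.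
have homE (f f' : hom H (Qvect k)) : (forall i, f (b i) = f' (b i)) -> f =1 f'.
  move=> ff' x; have [N [c [N0 xN]]] := bP x.
  have : (f x - f' x) *~ N = 0.
    have fE (g : hom H (Qvect k)) : g x *~ N = \sum_i g (b i) *~ c i.
      by rewrite -raddfMz xN raddf_sum; apply: eq_bigr => i _; rewrite raddfMz.
    rewrite mulrzBl !fE; apply/eqP; rewrite subr_eq0; apply/eqP/eq_bigr => i _.
    by rewrite ff'.
  by move=> /(Qvect_torsion_free N0) /eqP; rewrite subr_eq0 => /eqP.
have [|D_ [Dc DQ]] := @generic_sequence n k (J1 + J2 + J3)%type H QJ.
  move=> [[[[a c] i]|w]|[[[P p] Q] R]] m D.
  - have [div|ndiv] := pselect (divisible_by n 2 (e (a i))).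
      by exists 0, m, D; split=> [//||m'' D'' _ _ nd]; [exact: cong_refl | by case: nd].
    have [m' [D' [mm' DD' av]]] := @avoid_homs_from n k H H_tf (e \o a) (e c) i m D ndiv.
    by exists 0, m', D'; split=> // m'' D'' mm'' DD'' _ h g hh gg; apply: av.
  - have [[f fw f0]|no] := pselect (exists2 f : hom H (Qvect k),
      forall i, f (b i) = w i & exists x, f x != 0).
      have [x [m' [D' [mm' DD' av]]]] := avoid_homs_to_lattices n1 m D f0 HZ k0.
      exists x, m', D'; split=> // m'' D'' mm'' DD'' f' f'w _.
      by rewrite (homE f' f) => [|i]; [apply: av | rewrite f'w fw].
    exists 0, m, D; split=> //; first exact: cong_refl.
    by move=> m'' D'' _ _ f fw f0; case: no; exists f.
  - have [sc|nsc] := pselect [/\ Q = 0, p = 0 & R = P%:M].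
      by exists 0, m, D; split=> [//||m'' D'' _ _ nd]; [exact: cong_refl | by case: nd].
    have [m' [D' [mm' DD' av]]] := avoid_homs_between_lattices n1 m D nsc.
    by exists 0, m', D'; split=> // m'' D'' mm'' DD'' _; apply: av.
exists D_; split=> //.
- move=> h g hg i; apply: contrapT => ndiv.
  have [a aP] := @boolp.choice _ _ _ (fun i => eP (h i)).
  have [c gc] := eP g.
  have [w [M]] := DQ (inl (inl ([ffun i => a i], c, i))).
  move/(_ M (leqnn M)); rewrite /QJ /Q1 => avoid.
  apply: (avoid _ h g _ gc (hg M)) => [|i']; last by rewrite ffunE.
  rewrite ffunE => div; apply: ndiv; rewrite -[h i](subrK (e (a i))).
  apply: (subgroupD (divisible_by_subgroup n H 2)) => //.
  by have [y yE] := torsion_divisible H_tf 2 (aP i); exists y.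
- move=> f latf x; apply/eqP; apply: contrapT => /negP fx.
  have [y [M yM]] := DQ (inl (inr [ffun i => f (b i)])).
  have [m laty] := latf y.
  apply: (yM (maxn M m) (leq_maxl _ _) f) => [i||]; first by rewrite ffunE.
    by exists x.
  by apply: (lat_cong n1 (leq_maxr M m)) laty; apply: cong_chain => //; apply: leq_maxr.
- move=> P p Q R sc; apply: contrapT => nsc.
  have [w [M]] := DQ (inr (P, p, Q, R)).
  by move/(_ M (leqnn M)); apply.
Qed.

(** * The pullbacks *)

Lemma intrQ_inj (a b : int) : a%:~R = b%:~R :> rat -> a = b.
Proof. by move=> /eqP; rewrite eqr_int => /eqP. Qed.

Lemma pair_eq (A B : Type) (x y : A * B) : x.1 = y.1 -> x.2 = y.2 -> x = y.
Proof. by case: x y => [a b] [a' b'] /= -> ->. Qed.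

Section Pullback.
Variables (n k : nat) (H : zmodType) (g : 'I_k.+1 -> H) (D_ : nat -> 'rV[int]_k.+1).
Hypothesis n_gt1 : (1 < n)%N.
Hypothesis H_tf : forall y : H, y *+ n = 0 -> y = 0.
Hypothesis D_cong : forall m, cong n m (D_ m) (D_ m.+1).
Hypothesis homs_from : forall (h : 'I_k.+1 -> H) y,
  (forall m, divisible_by n m (y - comb h (D_ m 0))) -> forall i, divisible_by n 2 (h i).
Hypothesis homs_to : forall f : hom H (Qvect k.+1),
  (forall x, exists m, lat n m (D_ m) (f x)) -> forall x, f x = 0.
Hypothesis endos : forall P p Q R,
  (forall m, exists z, defect P p Q R (D_ m) = (n ^ m)%N%:Z *: z) ->
  [/\ Q = 0, p = 0 & R = P%:M].

Local Notation V := (Qvect k.+1).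
Local Notation zrow := 'rV[int]_k.+1.

Let n_gt0 : (0 < n)%N := ltnW n_gt1.

Lemma lat_le m m' c : (m <= m')%N -> lat n m (D_ m) c -> lat n m' (D_ m') c.
Proof. by move=> mm'; apply: lat_cong => //; apply: cong_chain. Qed.

(** The group C of the overview; the n-adic vector D enters only through its approximations
    [D_ m]. *)
Definition lattice_union : set V := [set c | exists m, lat n m (D_ m) c]%classic.

Lemma lattice_union_subgroup : subgroup lattice_union.
Proof.
split; first by exists 0%N; case: (lat_subgroup n 0 (D_ 0%N)).
move=> c c' [m cm] [m' cm']; exists (maxn m m').
apply: (lat_subgroup _ _ _).2.
  by apply: lat_le cm; apply: leq_maxl.
by apply: lat_le cm'; apply: leq_maxr.
Qed.

Definition limit_group : zmodType := subgrp (closed_of lattice_union_subgroup).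

Lemma limit_group_val_lat (c : limit_group) : lattice_union (subgrp_val c).
Proof. by case: c => c cC; have /closed_ofP := cC. Qed.

Fact pt_in m (w : int * zrow) : pt n m (D_ m) w.1 w.2 \in closed_of lattice_union_subgroup.
Proof. by apply/closed_ofP; exists m, w.1, w.2. Qed.
Fact ptC_proof m : zmod_morphism (fun w => Subgrp (pt_in m w)).
Proof. by move=> w w'; apply: val_inj; rewrite /= ptB. Qed.
Definition ptC m : hom (int * zrow)%type limit_group := mk_hom (ptC_proof m).

Lemma ptC_val m a z : subgrp_val (ptC m (a, z)) = pt n m (D_ m) a z.
Proof. by []. Qed.

Lemma ptC_surj (c : limit_group) : exists m a z, c = ptC m (a, z).
Proof.
by have [m [a [z cE]]] := limit_group_val_lat c; exists m, a, z; apply: val_inj.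
Qed.

(** At higher precision the first coefficient is divisible by n^j, so the unit vectors generate C
    modulo n^j. *)
Lemma ptC_step m j a z : exists d, ptC m (a, z) = ptC (m + j) (a * (n ^ j)%N%:Z, z + a *: d).
Proof.
have [d dE] := cong_chain D_cong (leq_addr j m); exists d; apply: val_inj.
by rewrite /= (pt_cong n_gt1 m j (D_ m) d) -dE.
Qed.

Lemma ptC0 m m' z : ptC m (0, z) = ptC m' (0, z).
Proof. by apply: val_inj; rewrite /= /pt !mul0r !scale0r. Qed.

Definition unitC i : limit_group := ptC 0 (0, delta_mx 0 i).
(** The vector (1, 0): the coordinate [D_ 0] cancels the shift in [pt]. *)
Definition oneC : limit_group := ptC 0 (1, D_ 0%N).

Lemma nX_neq0 m : (n ^ m)%N%:R != 0 :> rat.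
Proof. by rewrite pnatr_eq0 -lt0n expn_gt0 n_gt0. Qed.

Lemma oneCE m : oneC = ptC m ((n ^ m)%N%:Z, D_ m).
Proof.
apply: val_inj; rewrite /= /pt expn0 divr1 -[(Posz (n ^ m))%:~R]/((n ^ m)%N%:R : rat).
by rewrite divff ?nX_neq0 // !scale1r !subrr.
Qed.

Lemma ptC_units m z : ptC m (0, z) = comb unitC (z 0).
Proof.
rewrite (ptC0 m 0) [in LHS](row_sum_delta z).
have e0 : zmod_morphism (fun z : zrow => ptC 0 (0, z)).
  by move=> y y'; rewrite -raddfB -[X in _ = ptC _ X]/(0 - 0, y - y') subrr.
rewrite -[LHS](mk_homE e0) raddf_sum; apply: eq_bigr => i _.
by rewrite -[z 0 i in LHS]intz scaler_int raddfMz.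
Qed.

Lemma ptC_hom (A : zmodType) (f : hom limit_group A) m a z :
  f (ptC m (a, z)) = f (ptC m (1, 0)) *~ a + comb (f \o unitC) (z 0).
Proof.
have e1 : zmod_morphism (fun b : int => ptC m (b, 0)).
  by move=> b b'; rewrite -raddfB -[X in _ = ptC _ X]/(b - b', 0 - 0) subrr.
have -> : ptC m (a, z) = ptC m (1, 0) *~ a + ptC m (0, z).
  rewrite -(mk_homE e1 1) -raddfMz intz mk_homE -raddfD; congr (ptC m _).
  by rewrite -[RHS]/(a + 0, 0 + z) addr0 add0r.
rewrite raddfD raddfMz; congr (_ + _).
rewrite ptC_units raddf_sum; apply: eq_bigr => i _; exact: raddfMz.
Qed.

Lemma hom_oneC (A : zmodType) (f : hom limit_group A) m :
  f oneC = f (ptC m (1, 0)) *+ n ^ m + comb (f \o unitC) (D_ m 0).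
Proof. by rewrite (oneCE m) ptC_hom pmulrn. Qed.

(** [homs_from] treats the unit vectors; raising the precision by 2 makes the remaining coefficient
    a multiple of n^2. *)
Lemma hom_from_C (f : hom limit_group H) c : divisible_by n 2 (f c).
Proof.
have fu i : divisible_by n 2 (f (unitC i)).
  apply: (homs_from (h := f \o unitC) (y := f oneC)) => m.
  by exists (f (ptC m (1, 0))); rewrite (hom_oneC f m) addrK.
have [m [a [z ->]]] := ptC_surj c; have [d ->] := ptC_step m 2 a z.
rewrite ptC_hom; apply: (subgroupD (divisible_by_subgroup n H 2)).
  by exists (f (ptC (m + 2) (1, 0)) *~ a); rewrite mulrzA -pmulrn.
exact: (@subgroup_sum _ [set x | divisible_by n 2 x]%classic _ _ _ _
  (divisible_by_subgroup n H 2) (fun i _ => subgroupMz _ (divisible_by_subgroup n H 2) (fu i))).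
Qed.

Lemma limit_group_torsion_free (c : limit_group) a : a != 0 -> c *~ a = 0 -> c = 0.
Proof.
move=> a0 ca; apply: val_inj; apply: (Qvect_torsion_free a0).
by rewrite -[LHS](raddfMz (subgrp_inc _)) ca.
Qed.

Lemma limit_group_valMz (c : limit_group) a : subgrp_val (c *~ a) = subgrp_val c *~ a.
Proof. exact: (raddfMz (subgrp_inc _)). Qed.

Lemma unitC_multiple (c : limit_group) i (N P : int) : N != 0 ->
  c *~ N = unitC i *~ P -> exists s, P = N * s.
Proof.
have [m [a [z ->]]] := ptC_surj c => N0 /(congr1 subgrp_val).
rewrite !limit_group_valMz => e.
have := congr1 (fun c : V => c.1) e; rewrite !Qvect_fstMz /= mulr0z !mul0r.
move/eqP; rewrite mulf_eq0 intr_eq0 (negPf N0) orbF mulf_eq0 invr_eq0.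
rewrite (negPf (nX_neq0 m)) orbF intr_eq0 => /eqP a0.
have := congr1 (fun c : V => c.2 0 i) e; rewrite !Qvect_sndMz /= a0 mulr0z !mul0r !scale0r !subr0.
rewrite !mxE !eqxx mulr1 => /esym e'; exists (z 0 i).
by apply/eqP; rewrite -(eqr_int rat) rmorphM /= e'.
Qed.

Lemma lat_integral m D (c : V) : lat n m D c ->
  exists P p, c.1 * (n ^ m)%N%:R = P%:~R /\ (n ^ m)%N%:R *: c.2 = iv p.
Proof.
move=> /(latP n_gt1) [[a ca] [z cz]]; exists a, ((n ^ m)%N%:Z *: z - a *: D).
split=> //; rewrite ivB !ivZ -ca -cz -[(Posz _)%:~R]/((n ^ m)%N%:R : rat).
by rewrite scalerDr scalerA [_ * c.1]mulrC addrK.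
Qed.

(** A power n^M clears the denominators of f on (1, 0) and the unit vectors, leaving an integer
    matrix. That f preserves C bounds the defect of this matrix, and [endos] makes it scalar. *)
Lemma endo_scalar (f : hom limit_group limit_group) : exists s : int, forall c, f c = c *~ s.
Proof.
have [mu muP] := @boolp.choice _ _ _ (fun i => limit_group_val_lat (f (unitC i))).
have [m0 m0P] := limit_group_val_lat (f oneC).
pose M := maxn m0 (\max_i mu i).
have muM i : (mu i <= M)%N by apply: leq_trans (leq_maxr _ _); apply: leq_bigmax.
have [P [p [Pf pf]]] := lat_integral (lat_le (leq_maxl _ _ : (m0 <= M)%N) m0P).
have [Qf QfP] := @boolp.choice _ _ _ (fun i => lat_integral (lat_le (muM i) (muP i))).
have [Rf QRfP] := @boolp.choice _ _ _ QfP.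
set N : rat := (n ^ M)%N%:R in Pf pf QRfP.
have N0 : N != 0 by exact: nX_neq0.
pose Q : 'cV[int]_k.+1 := \col_i Qf i.
pose R : 'M[int]_k.+1 := \matrix_i Rf i.
pose f1 c := (subgrp_val (f c)).1.
pose f2 j c := (subgrp_val (f c)).2 0 j.
have f1B : zmod_morphism f1 by move=> c c'; rewrite /f1 raddfB.
have f2B j : zmod_morphism (f2 j) by move=> c c'; rewrite /f2 raddfB /= !mxE.
have [m|Q0 p0 R0] := @endos P p Q R.
  have e1 := hom_oneC (mk_hom f1B) m; have e2 j := hom_oneC (mk_hom (f2B j)) m.
  set y := ptC m (1, 0) in e1 e2.
  have [m' latm'] := limit_group_val_lat (f y).
  have latM := lat_le (leq_maxr m m') latm'.
  have [d dE] := cong_chain D_cong (leq_maxl m m').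
  have /(latP n_gt1) [_ [z zE]] := latM.
  have [b bdef] : exists b : int, P - (D_ m *m Q) 0 0 = b by eexists.
  have bE : N * f1 y * (n ^ m)%N%:R = b%:~R.
    have cE : N * comb (mk_hom f1B \o unitC) (D_ m 0) = ((D_ m *m Q) 0 0)%:~R.
      rewrite /comb mulr_sumr mxE rmorph_sum; apply: eq_bigr => i _ /=.
      by rewrite -mulrzr mulrA [N * _]mulrC (QRfP i).1 mxE intrM mulrC.
    rewrite -bdef intrB -cE -Pf -/(f1 oneC) -(mk_homE f1B oneC) e1 mk_homE -mulr_natr.
    by ring.
  have bbE j : N * f2 j y * (n ^ m)%N%:R = ((p - D_ m *m R) 0 j)%:~R.
    have cE : N * comb (mk_hom (f2B j) \o unitC) (D_ m 0) = ((D_ m *m R) 0 j)%:~R.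
      rewrite /comb mulr_sumr mxE rmorph_sum; apply: eq_bigr => i _ /=.
      have := congr1 (fun v : 'rV[rat]_k.+1 => v 0 j) (QRfP i).2; rewrite !mxE => e.
      by rewrite -mulrzr mulrA e intrM mulrC.
    have pE : N * f2 j oneC = (p 0 j)%:~R.
      by have := congr1 (fun v : 'rV[rat]_k.+1 => v 0 j) pf; rewrite !mxE.
    have -> : (p - D_ m *m R) 0 j = p 0 j - (D_ m *m R) 0 j by rewrite mxE [X in _ + X = _]mxE.
    rewrite intrB -cE -pE -(mk_homE (f2B j) oneC) e2 mk_homE -mulr_natr.
    by ring.
  (* The image of y is integral with respect to [D_ (maxn m m')]; d accounts for its difference from
     [D_ m]. *)
  exists ((n ^ M)%N%:Z *: z - b *: d); apply/rowP => j.
  apply: intrQ_inj.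
  have -> : defect P p Q R (D_ m) 0 j = (p - D_ m *m R) 0 j + b * D_ m 0 j.
    by rewrite [LHS]mxE [X in _ + X = _]mxE bdef.
  have -> : ((n ^ m)%N%:Z *: ((n ^ M)%N%:Z *: z - b *: d)) 0 j
    = (n ^ m)%N%:Z * ((n ^ M)%N%:Z * z 0 j - b * d 0 j) by rewrite !mxE.
  rewrite intrD !intrM intrB !intrM -bbE -bE.
  have := congr1 (fun v : 'rV[rat]_k.+1 => v 0 j) zE.
  have := congr1 (fun v : zrow => v 0 j) dE.
  rewrite !mxE => -> <-; rewrite intrD intrM.
  rewrite -[(Posz (n ^ m))%:~R]/((n ^ m)%N%:R : rat) -[(Posz (n ^ M))%:~R]/N.
  rewrite -/(f1 y) -/(f2 j y); ring.
have fone : f oneC *~ (n ^ M)%N%:Z = oneC *~ P.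
  apply: val_inj; rewrite /= !limit_group_valMz; apply: pair_eq.
    by rewrite !Qvect_fstMz Pf /= expn0 divr1 mul1r.
  by rewrite !Qvect_sndMz -[(Posz _)%:~R]/N pf p0 /= expn0 divr1 !scale1r subrr scaler0 /iv map_mx0.
have funit i : f (unitC i) *~ (n ^ M)%N%:Z = unitC i *~ P.
  have [Qi Ri] := QRfP i.
  have Qi0 : Qf i = 0 by have := congr1 (fun v : 'cV_k.+1 => v i 0) Q0; rewrite !mxE.
  have Ri0 : Rf i = P *: delta_mx 0 i.
    by have := congr1 (row i) R0; rewrite rowK rowE mul_mx_scalar.
  apply: val_inj; rewrite /= !limit_group_valMz; apply: pair_eq.
    by rewrite !Qvect_fstMz Qi Qi0 /= mulr0z !mul0r.
  by rewrite !Qvect_sndMz -[(Posz _)%:~R]/N Ri Ri0 ivZ /= mulr0z mul0r scale0r subr0.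
have tB : zmod_morphism (fun c => f c *~ (n ^ M)%N%:Z - c *~ P).
  move=> c c'; rewrite raddfB !mulrzBl !opprB addrACA [in RHS]addrACA.
  by rewrite [- (f c' *~ _) - _]addrC.
pose t : hom limit_group limit_group := mk_hom tB.
have t0 c : t c = 0.
  have tu : t \o unitC =1 fun=> 0.
    by move=> i; rewrite -[LHS]/(f (unitC i) *~ _ - unitC i *~ P) funit subrr.
  have comb0 z : comb (t \o unitC) z = 0 by rewrite /comb big1 // => i _; rewrite tu mul0rz.
  have [m [a [z ->]]] := ptC_surj c; rewrite ptC_hom comb0 addr0.
  have tone : t oneC = 0 by rewrite -[LHS]/(f oneC *~ _ - oneC *~ P) fone subrr.
  have := hom_oneC t m; rewrite comb0 addr0 tone pmulrn => /esym.
  move=> /limit_group_torsion_free -> //; first by rewrite mul0rz.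
  by rewrite eqz_nat -lt0n expn_gt0 n_gt0.
have nM0 : (n ^ M)%N%:Z != 0 by rewrite eqz_nat -lt0n expn_gt0 n_gt0.
(* The scalar P for n^M f is divisible by n^M, because a unit vector is not properly divisible in
   C. *)
have [s sE] := unitC_multiple nM0 (funit ord0).
exists s => c; apply/eqP; rewrite -subr_eq0; apply/eqP/(limit_group_torsion_free nM0).
by rewrite mulrzBl -mulrzA [s * _]mulrC -sE; exact: t0.
Qed.

Lemma comb_rowB (h : 'I_k.+1 -> H) (z z' : zrow) :
  comb h ((z - z') 0) = comb h (z 0) - comb h (z' 0).
Proof. by rewrite /comb -sumrB; apply: eq_bigr => i _; rewrite !mxE mulrzBr. Qed.

Local Notation nH := (divisible_by n 1).
Let nHs : subgroup [set x : H | nH x]%classic := divisible_by_subgroup n H 1.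

Lemma nH_mul (x : H) : nH (x *+ n). Proof. by exists x; rewrite expn1. Qed.

Lemma nHP (x : H) : nH x -> exists y, x = y *+ n.
Proof. by move=> [y ->]; exists y; rewrite expn1. Qed.

Definition pullback_at (a : hom H H) m (x : H * V) := exists b (z : zrow),
  x.2 = pt n m (D_ m) (b * n%:Z) z /\ nH (a x.1 - comb g (z 0)).

(* The coordinate z of c is determined modulo n, independently of m, once the
   first coordinate of c is a multiple of n: the class of [comb g z] in H / nH is
   the image of c. *)
Definition pullback (a : hom H H) : set (H * V)%type :=
  [set x | exists m, pullback_at a m x]%classic.

Lemma pullback_at_le a m m' x : (m <= m')%N -> pullback_at a m x -> pullback_at a m' x.
Proof.
move=> mm' [b [z [xE ax]]].
have [d dE] := cong_chain D_cong mm'.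
exists (b * (n ^ (m' - m))%N%:Z), (z + (b * n%:Z) *: d); split.
  rewrite xE (pt_cong n_gt1 m (m' - m) (D_ m) d) -dE subnKC //.
  by congr (pt _ _ _ _ _); rewrite mulrAC.
rewrite combDZ opprD addrA; apply: (subgroupD nHs ax); apply: (subgroupN nHs).
by rewrite mulrzA -pmulrn; apply: nH_mul.
Qed.

Lemma pullback_subgroup a : subgroup (pullback a).
Proof.
split.
  exists 0%N, 0, 0; split; last first.
    by rewrite raddf0 sub0r; apply: (subgroupN nHs); rewrite /comb big1;
       [case: nHs | move=> i _; rewrite mxE mulr0z].
  by rewrite mul0r pt00.
move=> [x c] [x' c'] [m xm] [m' xm'].
have [b [z /= [-> az]]] := pullback_at_le (leq_maxl m m') xm.
have [b' [z' /= [-> az']]] := pullback_at_le (leq_maxr m m') xm'.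
exists (maxn m m'), (b - b'), (z - z'); rewrite /= mulrBl ptB; split=> //.
rewrite raddfB comb_rowB.
have -> : a x - a x' - (comb g (z 0) - comb g (z' 0)) =
  (a x - comb g (z 0)) - (a x' - comb g (z' 0)).
  by rewrite !opprB addrACA [in RHS]addrACA [- a x' - _]addrC.
exact: nHs.2.
Qed.

Definition pullback_group a : zmodType := subgrp (closed_of (pullback_subgroup a)).

Lemma pullback_mem a (x : pullback_group a) : pullback a (subgrp_val x).
Proof. by case: x => x xX; have /closed_ofP := xX. Qed.

Lemma pullback_snd a (x : pullback_group a) : (subgrp_val x).2 \in closed_of lattice_union_subgroup.
Proof.
by apply/closed_ofP; have [m [b [z [-> _]]]] := pullback_mem x; exists m; eexists; eexists.
Qed.

Fact pullback_sndB a :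
  zmod_morphism (fun x : pullback_group a => Subgrp (pullback_snd x) : limit_group).
Proof. by move=> x y; apply: val_inj. Qed.
Definition sndX a : hom (pullback_group a) limit_group := mk_hom (@pullback_sndB a).

Fact pullback_fstB a : zmod_morphism (fun x : pullback_group a => (subgrp_val x).1).
Proof. by []. Qed.
Definition fstX a : hom (pullback_group a) H := mk_hom (@pullback_fstB a).

Lemma pullback_eq a (x y : pullback_group a) : fstX a x = fstX a y -> sndX a x = sndX a y -> x = y.
Proof.
move=> xy1 /(congr1 subgrp_val) xy2; apply: val_inj; exact: pair_eq.
Qed.

Lemma pullback_cond a (x : pullback_group a) m z : sndX a x = ptC m (0, z) ->
  nH (a (fstX a x) - comb g (z 0)).
Proof.
have [m' [b [z' [xE ax]]]] := pullback_mem x => xz.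
have : ptC m' (b * n%:Z, z') = ptC m' (0, z).
  by rewrite (ptC0 m' m) -xz; apply: val_inj; rewrite /= xE.
move=> /(congr1 subgrp_val); rewrite !ptC_val => /(pt_inj n_gt1) [_ <-].
exact: ax.
Qed.

Fact jX_in a h : (h *+ n, 0) \in closed_of (pullback_subgroup a).
Proof.
apply/closed_ofP; exists 0%N, 0, 0; split.
  by rewrite mul0r pt00.
rewrite /= raddfMn /comb big1; first by rewrite subr0; apply: nH_mul.
by move=> i _; rewrite mxE mulr0z.
Qed.
Fact jX_B a : zmod_morphism (fun h => Subgrp (jX_in a h) : pullback_group a).
Proof.
by move=> h h'; apply: val_inj; apply: pair_eq; rewrite /= ?mulrnBl // subrr.
Qed.
Definition jX a : hom H (pullback_group a) := mk_hom (jX_B a).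

Lemma fst_jX a h : fstX a (jX a h) = h *+ n. Proof. by []. Qed.
Lemma snd_jX a h : sndX a (jX a h) = 0. Proof. exact: val_inj. Qed.

Fact kX_in a (c : limit_group) : (0, subgrp_val (c *+ n)) \in closed_of (pullback_subgroup a).
Proof.
apply/closed_ofP; have [m [b [z ->]]] := ptC_surj c.
exists m, b, (z *+ n); split.
  rewrite -raddfMn /=; congr (pt _ _ _ _ _).
    by elim: (n) => [|i IHi]; rewrite ?mulr0 // mulrS /= IHi -add1n PoszD mulrDr mulr1.
  by elim: (n) => [|i IHi] //; rewrite !mulrS /= IHi.
rewrite raddf0 sub0r; apply: (subgroupN nHs).
have -> : comb g ((z *+ n) 0) = comb g (z 0) *+ n.
  rewrite /comb -sumrMnl; apply: eq_bigr => i _.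
  by rewrite mulmxnE -[z 0 i *+ n]mulr_natr natz mulrzA -pmulrn.
exact: nH_mul.
Qed.
Fact kX_B a : zmod_morphism (fun c => Subgrp (kX_in a c) : pullback_group a).
Proof.
by move=> c c'; apply: val_inj; apply: pair_eq; rewrite /= ?subrr // mulrnBl.
Qed.
Definition kX a : hom limit_group (pullback_group a) := mk_hom (kX_B a).

Lemma fst_kX a c : fstX a (kX a c) = 0. Proof. by []. Qed.
Lemma snd_kX a c : sndX a (kX a c) = c *+ n. Proof. exact: val_inj. Qed.

(** So n X_a lies in n H + n C, and a homomorphism from X_a is controlled, up to division by n, by
    its composites with [jX] and [kX]. *)
Lemma pullback_mulrn a (x : pullback_group a) : x *+ n = jX a (fstX a x) + kX a (sndX a x).
Proof.
apply: pullback_eq; rewrite raddfMn raddfD.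
  by rewrite fst_jX fst_kX addr0.
by rewrite snd_jX snd_kX add0r.
Qed.

Lemma pullback_make (a : hom H H) h (z : zrow) : nH (a h - comb g (z 0)) ->
  exists x : pullback_group a, fstX a x = h /\ sndX a x = ptC 0 (0, z).
Proof.
move=> ahz; have xX : (h, subgrp_val (ptC 0 (0, z))) \in closed_of (pullback_subgroup a).
  by apply/closed_ofP; exists 0%N, 0, z; rewrite mul0r.
by exists (Subgrp xX); split=> //; apply: val_inj.
Qed.

Lemma nZ_neq0 : n%:Z != 0.
Proof. by rewrite eqz_nat -lt0n n_gt0. Qed.

(** As Hom(H, C) = 0, f maps the image of [jX] to elements with second coordinate 0; their first
    coordinate lies in n H by injectivity of b modulo n, and division by n gives v. On C, f is a
    scalar. *)
Lemma pullback_hom (a b : hom H H) (f : hom (pullback_group a) (pullback_group b)) :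
  (forall h, exists h', nH (a h' - h)) -> (forall h, nH (b h) -> nH h) ->
  exists (v : hom H H) (s : int), [/\ forall h, f (jX a h) = jX b (v h),
    forall x, sndX b (f x) = sndX a x *~ s
    & forall x, nH (fstX b (f x) - v (fstX a x))].
Proof.
move=> a_surj b_inj.
have snd0 h : sndX b (f (jX a h)) = 0.
  apply: val_inj.
  apply: (homs_to (f := (subgrp_inc _ \o (sndX b \o (f \o jX a))) : {additive _ -> _})) => x.
  exact: limit_group_val_lat.
have [v0 v0E] : {v : H -> H & forall h, fstX b (f (jX a h)) = v h *+ n}.
  apply: (@boolp.choice H H (fun h y => fstX b (f (jX a h)) = y *+ n)) => h; apply/nHP/b_inj.
  have /pullback_cond : sndX b (f (jX a h)) = ptC 0 (0, 0) by rewrite snd0 raddf0.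
  by rewrite /comb big1 ?subr0 // => i _; rewrite mxE mulr0z.
have vB : zmod_morphism v0.
  move=> h h'; apply/eqP; rewrite -subr_eq0; apply/eqP/H_tf.
  rewrite !mulrnBl -!v0E; apply/eqP; rewrite subr_eq0; apply/eqP.
  exact: (raddfB ((fstX b \o (f \o jX a)) : {additive H -> H})).
pose v := mk_hom vB.
have fj h : f (jX a h) = jX b (v h).
  by apply: pullback_eq; [rewrite v0E fst_jX | rewrite snd0 snd_jX].
have [t tE] := endo_scalar ((sndX b \o (f \o kX a)) : {additive limit_group -> limit_group}).
have snd_n x : sndX b (f x) *+ n = sndX a x *~ t.
  by rewrite -!raddfMn pullback_mulrn !raddfD fj snd_jX add0r; exact: tE.
(* An element of X_a over a unit vector, which is not properly divisible in C, shows that n divides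
   t. *)
have [h ah] := a_surj (g ord0).
have [|x [_ x2]] := @pullback_make a h (delta_mx 0 ord0); first by rewrite comb_delta.
have [|s ts] := @unitC_multiple (sndX b (f x)) ord0 n t nZ_neq0.
  by rewrite -pmulrn snd_n x2.
exists v, s; split=> // [y|y].
  apply/eqP; rewrite -subr_eq0; apply/eqP/(limit_group_torsion_free nZ_neq0).
  by rewrite mulrzBl -pmulrn snd_n ts [_ * s]mulrC mulrzA subrr.
(* The C-part adds an element of n^2 H to n times the first coordinate, hence one of n H after
   division. *)
have [w wE] := hom_from_C ((fstX b \o (f \o kX a)) : {additive limit_group -> H}) (sndX a y).
exists w; rewrite expn1; apply/eqP; rewrite -subr_eq0; apply/eqP/H_tf.
have e : fstX b (f y) *+ n = v (fstX a y) *+ n + w *+ n ^ 2.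
  have -> : fstX b (f y) *+ n = fstX b (f (y *+ n)) by rewrite !raddfMn.
  by rewrite pullback_mulrn !raddfD fj fst_jX; congr (_ + _); exact: wE.
by rewrite !mulrnBl e -mulrnA mulnn [X in X - _ - _]addrC addrK subrr.
Qed.

Section Units.
Variables a b : hom H H.
Hypothesis abK : forall x, nH (a (b x) - x).
Hypothesis baK : forall x, nH (b (a x) - x).

Lemma unit_inj h : nH (a h) -> nH h.
Proof.
move=> [y ahE]; rewrite -[h](subKr (b (a h))) ahE.
apply: (nHs.2); last by rewrite -ahE; apply: baK.
by exists (b y); rewrite raddfMn.
Qed.

(* The matrix diag(a, b) is a product of elementary matrices modulo n, hence
   lifts to an automorphism of H + H. *)
Lemma pullback_stable_iso :
  zmod_iso (H * pullback_group a)%type (H * pullback_group (idfun : {additive H -> H}))%type.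
Proof.
pose i : hom H H := (idfun : {additive H -> H}).
have p1B : zmod_morphism (fun x : H * pullback_group a => fstX a x.2).
  by move=> x y; exact: (raddfB (fstX a)).
have p0B : zmod_morphism (fun x : H * pullback_group a => x.1) by [].
have q1B : zmod_morphism (fun y : H * pullback_group i => fstX i y.2).
  by move=> x y; exact: (raddfB (fstX i)).
have q0B : zmod_morphism (fun y : H * pullback_group i => y.1) by [].
pose p1 := mk_hom p1B; pose p0 := mk_hom p0B; pose q1 := mk_hom q1B; pose q0 := mk_hom q0B.
(* Three elementary operations take (h, y) to ([w], [u']), where [u'] is a y modulo n because a b =
   1 modulo n. Applied to the result, [r], [r'], [r''] recover [u], y and h. *)
pose u : hom _ _ := hom_comp a p1 - p0.
pose w : hom _ _ := p1 - hom_comp b u.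
pose u' : hom _ _ := u + hom_comp a w.
pose r : hom _ _ := q1 - hom_comp a q0.
pose r' : hom _ _ := q0 + hom_comp b r.
pose r'' : hom _ _ := hom_comp a r' - r.
have uE x : u x = a (fstX a x.2) - x.1 by [].
have wE x : w x = fstX a x.2 - b (u x) by [].
have u'E x : u' x = u x + a (w x) by [].
have rE y : r y = fstX i y.2 - a y.1 by [].
have r'E y : r' y = y.1 + b (r y) by [].
have r''E y : r'' y = a (r' y) - r y by [].
have u'a x : nH (u' x - a (fstX a x.2)).
  have -> : u' x - a (fstX a x.2) = - (a (b (u x)) - u x).
    by rewrite u'E wE raddfB addrCA addrAC subrr add0r opprB.
  by apply: (subgroupN nHs); apply: abK.
have ar' y : nH (a (r' y) - fstX i y.2).
  have -> : a (r' y) - fstX i y.2 = a (b (r y)) - r y.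
    by rewrite r'E raddfD rE opprB addrAC [LHS]addrC addrA.
  exact: abK.
have F_in x : (u' x, subgrp_val (sndX a x.2)) \in closed_of (pullback_subgroup i).
  apply/closed_ofP; have [m [c [z [xE ax]]]] := pullback_mem x.2; exists m, c, z; split=> //.
  rewrite -[X in nH X]/(u' x - comb g (z 0)) -[u' x](subrK (a (fstX a x.2))) -addrA.
  exact: (subgroupD nHs (u'a x) ax).
have G_in y : (r' y, subgrp_val (sndX i y.2)) \in closed_of (pullback_subgroup a).
  apply/closed_ofP; have [m [c [z [yE ay]]]] := pullback_mem y.2; exists m, c, z; split=> //.
  rewrite -[X in nH X]/(a (r' y) - comb g (z 0)) -[a (r' y)](subrK (fstX i y.2)) -addrA.
  exact: (subgroupD nHs (ar' y) ay).
pose F x := (w x, Subgrp (F_in x) : pullback_group i).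
pose G y := (r'' y, Subgrp (G_in y) : pullback_group a).
have rF x : r (F x) = u x by rewrite rE -[fstX i _]/(u' x) u'E addrK.
have r'F x : r' (F x) = fstX a x.2 by rewrite r'E rF -[(F x).1]/(w x) wE subrK.
have wG y : w (G y) = y.1.
  by rewrite wE uE -[fstX a _]/(r' y) -[(G y).1]/(r'' y) r''E subKr r'E addrK.
have uG y : u (G y) = r y.
  by rewrite uE -[fstX a _]/(r' y) -[(G y).1]/(r'' y) r''E subKr.
apply: (@zmod_iso_can _ _ F G).
- move=> x y; apply: pair_eq; first exact: (raddfB w).
  by apply: val_inj; apply: pair_eq; [exact: (raddfB u') | by []].
- move=> x; apply: pair_eq; first by rewrite -[LHS]/(r'' (F x)) r''E r'F rF uE subKr.
  by apply: pullback_eq; [exact: r'F | apply: val_inj].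
- move=> y; apply: pair_eq; first exact: wG.
  apply: pullback_eq; last exact: val_inj.
  by rewrite -[LHS]/(u' (G y)) u'E uG wG rE subrK.
Qed.

(** Comparing f with its inverse on [jX] and [kX] makes v invertible and s a unit of Z. For x = (h,
    c) in X_1, f x has second coordinate s c and first coordinate v h modulo n; the condition
    defining X_a then says a (v h) = s h modulo n. *)
Lemma pullback_unit :
  (forall h, exists c y, h = comb g c + y *+ n) ->
  zmod_iso (pullback_group (idfun : {additive H -> H})) (pullback_group a) ->
  exists (v v' : hom H H) (s : int), [/\ cancel v v', cancel v' v, s = 1 \/ s = -1
    & forall h, nH (a (v h) - h *~ s)].
Proof.
move=> gP /zmod_iso_homs [f [f' [fK f'K]]].
have a_surj h : exists h', nH (a h' - h) by exists (b h).
have i_surj h : exists h', nH ((idfun : {additive H -> H}) h' - h).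
  by exists h; rewrite subrr; case: nHs.
have [v [s [fj fs fv]]] := pullback_hom f i_surj unit_inj.
have [v' [s' [f'j f's f'v]]] := pullback_hom f' a_surj (fun h nh => nh).
have jX_inj e h h' : jX e h = jX e h' -> h = h'.
  move=> /(congr1 (fstX e)); rewrite !fst_jX => hh'.
  by apply/eqP; rewrite -subr_eq0; apply/eqP/H_tf; rewrite mulrnBl hh' subrr.
exists v, v', s; split.
- by move=> h; apply: (@jX_inj idfun); rewrite -f'j -fj fK.
- by move=> h; apply: (@jX_inj a); rewrite -fj -f'j f'K.
- have ss' : s * s' = 1.
    have := f's (f (kX _ oneC)); rewrite fK fs snd_kX -!mulrzA pmulrn -mulrzA.
    move=> /esym/eqP; rewrite -subr_eq0 -mulrzBr => /eqP e.
    have e0 : n%:Z * (s * s') - n%:Z = 0.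
      apply/eqP; apply: contrapT => /negP N0; have oneC0 := limit_group_torsion_free N0 e.
      have := congr1 (fun c : limit_group => (subgrp_val c).1) oneC0.
      by rewrite /= expn0 divr1.
    apply: (mulfI nZ_neq0); rewrite mulr1; apply/eqP; by rewrite -subr_eq0 e0.
  have /eqP : (absz s * absz s')%N = 1%N by rewrite -abszM ss'.
  by rewrite muln_eq1 => /andP [/eqP s1 _]; lia.
move=> h; have [c [y hE]] := gP h.
have [z zE] : exists z : zrow, comb g (z 0) = comb g c.
  by exists (\row_i c i); apply: eq_bigr => i _; rewrite mxE.
have [|x [x1 x2]] := @pullback_make (idfun : {additive H -> H}) h z.
  by rewrite zE /= {1}hE addrC addKr; apply: nH_mul.
have fvx := fv x; rewrite x1 in fvx.
have /pullback_cond nax : sndX a (f x) = ptC 0 (0, s *: z).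
  by rewrite fs x2 ptC_units [RHS]ptC_units /comb mulrz_suml; apply: eq_bigr => i _;
     rewrite mxE mulrC mulrzA.
have av : nH (a (fstX a (f x)) - a (v h)).
  by have [t tE] := fvx; exists (a t); rewrite -raddfB tE raddfMn.
have cs : nH (comb g ((s *: z) 0) - h *~ s).
  have -> : comb g ((s *: z) 0) - h *~ s = - ((y *~ s) *+ n).
    have -> : comb g ((s *: z) 0) = comb g (z 0) *~ s.
      by rewrite /comb mulrz_suml; apply: eq_bigr => i _; rewrite mxE mulrC mulrzA.
    rewrite zE -mulrzBl {1}hE opprD addrA subrr add0r mulNrz.
    by rewrite !pmulrn -!mulrzA mulrC.
  by apply: (subgroupN nHs); apply: nH_mul.
have -> : a (v h) - h *~ s = - (a (fstX a (f x)) - a (v h)) +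
   ((a (fstX a (f x)) - comb g ((s *: z) 0)) + (comb g ((s *: z) 0) - h *~ s)).
  by rewrite opprB subrKA subrKA.
by apply: (subgroupD nHs); [apply: (subgroupN nHs) | apply: (subgroupD nHs)].
Qed.

End Units.

End Pullback.

(** * Lifting units *)

Lemma cancellation_unit (n r : nat) (H : zmodType) (a b : hom H H) : (1 < n)%N ->
  cancellation_property H -> rank_le H r ->
  (forall y : H, y *+ n = 0 -> y = 0) -> (forall (f : hom H int) x, f x = 0) ->
  (forall x, divisible_by n 1 (a (b x) - x)) ->
  (forall x, divisible_by n 1 (b (a x) - x)) ->
  exists (v v' : hom H H) (s : int), [/\ cancel v v', cancel v' v, s = 1 \/ s = -1
    & forall h, divisible_by n 1 (a (v h) - h *~ s)].
Proof.
move=> n1 Hc rH H_tf HZ abK baK.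
have [k [x xP]] := generators_mod (ltnW n1) rH H_tf.
(* The additional generator 0 makes their number positive, so that C has a unit vector and D a
   coordinate to vary. *)
pose g := extend x 0.
have gP h : exists c y, h = comb g c + y *+ n.
  have [c [y ->]] := xP h.
  exists (fun i => if unlift ord0 i is Some j then c j else 0), y.
  rewrite comb_extend mul0rz add0r; congr (_ + _).
  by apply: eq_bigr => i _; rewrite liftK.
have [D_ [D_cong homs_from homs_to endos]] := generic_lattices n1 (ltn0Sn k) rH H_tf HZ.
have iso := zmod_iso_sym (Hc _ _ (pullback_stable_iso g n1 D_cong abK)).
exact: (pullback_unit H_tf homs_from homs_to endos abK baK gP iso).
Qed.

Section WalkUnits.
Variables (H0 H : zmodType) (i : hom H H0) (p : hom H0 H) (n r : nat).
Hypothesis n_gt1 : (1 < n)%N.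
Hypothesis ipK : cancel i p.
Hypothesis ip_torsion : forall x, x - i (p x) \in torsion_part H0.
Hypothesis H_tf : forall y : H, y *+ n = 0 -> y = 0.

Let mod_torsion (f : endo H0) : walk_endo H0 := ring_proj (torsion_hom H0) f.
Let mod_n (f : walk_endo H0) := ring_proj (multiples (walk_endo H0) n) f.

Lemma hom_torsion (A B : zmodType) (f : hom A B) x :
  x \in torsion_part A -> f x \in torsion_part B.
Proof.
move=> /torsionP [m m0 xm]; apply/torsionP; exists m => //.
by rewrite -raddfMn xm raddf0.
Qed.

Lemma mod_nP (f g : endo H0) : mod_n (mod_torsion f) = mod_n (mod_torsion g) <->
  exists d : endo H0, forall x, f x - g x - d x *+ n \in torsion_part H0.
Proof.
have ev (d : endo H0) m x : (d *+ m) x = d x *+ m.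
  by elim: m => [|m IHm]; rewrite ?mulr0n // !mulrS homDE IHm.
split=> [/ring_proj_eq/multiplesP [q]|[d dP]]; last first.
  apply/ring_proj_eq/multiplesP; exists (mod_torsion d).
  rewrite -raddfMn -raddfB; apply/ring_proj_eq/torsion_homP => x.
  by rewrite !homDE !homNE ev.
rewrite -[q]ring_projK -raddfMn -raddfB => /ring_proj_eq /torsion_homP dP.
exists (repr q) => x; have := dP x.
by rewrite !homDE !homNE ev.
Qed.

Lemma mod_nM (f g : endo H0) :
  mod_n (mod_torsion (f * g)) = mod_n (mod_torsion f) * mod_n (mod_torsion g).
Proof. by rewrite /mod_n /mod_torsion !rmorphM. Qed.

(** Inserting [i \o p] between f and g changes the composite only by torsion, which is divisible by
    n in H. *)
Lemma compress_inverse (f g : endo H0) :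
  mod_n (mod_torsion f) * mod_n (mod_torsion g) = 1 ->
  forall x : H, divisible_by n 1 (p (f (i (p (g (i x))))) - x).
Proof.
have -> : 1 = mod_n (mod_torsion 1) by rewrite /mod_n /mod_torsion !rmorph1.
rewrite -mod_nM => /mod_nP [d dP] x.
have S := divisible_by_subgroup n H 1.
set t := g (i x) - i (p (g (i x))).
have tT : t \in torsion_part H0 by exact: ip_torsion.
have -> : p (f (i (p (g (i x))))) - x =
    p ((f * g : endo H0) (i x) - i x - d (i x) *+ n) + p (d (i x)) *+ n - p (f t).
  have -> : p ((f * g : endo H0) (i x) - i x - d (i x) *+ n) =
      p (f (g (i x))) - x - p (d (i x)) *+ n.
    by rewrite (raddfB p) (raddfB p) (raddfMn p) ipK.
  have -> : p (f t) = p (f (g (i x))) - p (f (i (p (g (i x))))).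
    by rewrite /t (raddfB f) (raddfB p).
  have cancel_terms (y1 y2 y3 y4 : H) : y2 - y3 = y1 - y3 - y4 + y4 - (y1 - y2).
    by rewrite subrK opprB [RHS]addrC addrA subrK.
  exact: cancel_terms.
apply: S.2; first apply: (subgroupD S).
- by apply: (torsion_divisible H_tf); apply: hom_torsion; apply: dP.
- by exists (p (d (i x))); rewrite expn1.
- by apply: (torsion_divisible H_tf); apply: hom_torsion; apply: (hom_torsion f).
Qed.

Definition expand (f : hom H H) : endo H0 := hom_comp i (hom_comp f p).

Lemma expand_unit (v v' : hom H H) (s : int) : cancel v v' -> cancel v' v ->
  s = 1 \/ s = -1 -> is_unit (mod_torsion (expand v' *~ s)).
Proof.
move=> vK v'K sE; have ss : s * s = 1 by case: sE => ->.
have aux (w w' : hom H H) : cancel w w' -> mod_torsion (expand w' *~ s * (expand w *~ s)) = 1.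
  move=> wK; rewrite mulrzAl mulrzAr -mulrzA ss mulr1z -[RHS]/(mod_torsion 1).
  apply/ring_proj_eq/torsion_homP => x; rewrite homDE homNE endoME.
  rewrite -[X in X \in _]/(i (w' (p (i (w (p x))))) - x) ipK wK -opprB rpredN.
  exact: ip_torsion.
by exists (mod_torsion (expand v *~ s)); split; rewrite -rmorphM; exact: aux.
Qed.

Lemma lift_unit : cancellation_property H -> rank_le H r ->
  (forall (f : hom H int) x, f x = 0) ->
  forall u : ring_quot (multiples (walk_endo H0) n), is_unit u ->
  exists2 v : walk_endo H0, is_unit v & mod_n v = u.
Proof.
move=> Hc rH HZ u [w [wu uw]].
pose f : endo H0 := repr (repr u); pose g : endo H0 := repr (repr w).
have uE : u = mod_n (mod_torsion f) by rewrite /mod_n /mod_torsion !ring_projK.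
have wE : w = mod_n (mod_torsion g) by rewrite /mod_n /mod_torsion !ring_projK.
pose a := hom_comp p (hom_comp f i); pose b := hom_comp p (hom_comp g i).
have abK x : divisible_by n 1 (a (b x) - x).
  by apply: compress_inverse; rewrite -uE -wE.
have baK x : divisible_by n 1 (b (a x) - x).
  by apply: compress_inverse; rewrite -uE -wE.
have [v [v' [s [vK v'K sE vP]]]] := cancellation_unit n_gt1 Hc rH H_tf HZ abK baK.
exists (mod_torsion (expand v' *~ s)); first exact: expand_unit vK v'K sE.
rewrite uE; apply/esym/mod_nP.
(* Substituting v' h into a v = s modulo n shows that a - s v' has values in n H; without n-torsion
   its quotient by n is additive. *)
have [d0 d0P] : {d0 : H -> H & forall h, a h - v' h *~ s = d0 h *+ n}.
  apply: (@boolp.choice H H (fun h y => a h - v' h *~ s = y *+ n)) => h.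
  by have [y] := vP (v' h); rewrite v'K expn1 => yE; exists y.
have dB : zmod_morphism d0.
  move=> h h'; apply/eqP; rewrite -subr_eq0; apply/eqP/H_tf.
  rewrite !mulrnBl -!d0P (raddfB a) (raddfB v') !mulrzBl; apply/eqP; rewrite subr_eq0; apply/eqP.
  by rewrite !opprB addrACA [in RHS]addrACA [- a h' - _]addrC.
exists (expand (mk_hom dB)) => x.
have ev (e : endo H0) y : (e *~ s) y = e y *~ s by case: sE => ->; rewrite ?mulr1z // !mulrN1z.
rewrite ev -[expand v' x]/(i (v' (p x))) -[expand _ x]/(i (d0 (p x))).
rewrite -raddfMn -d0P raddfB raddfMz opprB addrA subrK.
have -> : f x - i (a (p x)) = (f x - i (p (f x))) + i (p (f (x - i (p x)))).
  by rewrite 3!raddfB /= addrA subrK.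
apply: rpredD; first exact: ip_torsion.
by apply: hom_torsion; apply: hom_torsion; apply: (hom_torsion f).
Qed.

End WalkUnits.

Theorem corollary4p6 (G : zmodType)
  (G_self_small : self_small G)
  (G_rank : exists2 r : nat, torsion_free_rank G r & (r <= 4)%N)
  (G_cancel : cancellation_property G) :
  exists F H : zmodType,
    [/\ zmod_iso G (F * H)%type,
        free_group F
      & unit_lifting_property (walk_endo H)].
Proof.
have [r /torsion_free_rank_le rG _] := G_rank.
have [k [H0 [i0 [p0 [ip0K isoG HZ]]]]] := free_part rG.
exists ('rV[int]_k : zmodType), H0; split=> //; first exact: free_row.
(* For n = 1 the quotient ring is zero and 1 lifts everything. *)
move=> n n0 u uU; have [n1|n1] := leqP n 1%N.
  exists 1; first by exists 1; rewrite mulr1.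
  rewrite -[u]ring_projK; apply/ring_proj_eq/multiplesP.
  move: (1 - repr u) => y; exists y.
  have -> : n = 1%N by lia.
  by rewrite mulr1n.
(* The retract H depends on n, while the summand H0 does not. *)
have [H [i [p [ipK tors H_tf]]]] := torsion_free_retract n0 G_self_small ip0K.
apply: (lift_unit (r := r) n1 ipK tors H_tf) => //.
- exact: retract_cancellation ipK (retract_cancellation ip0K G_cancel).
- exact: rank_le_inj (can_inj ipK) (rank_le_inj (can_inj ip0K) rG).
- move=> f x; rewrite -[x]ipK; exact: (HZ (hom_comp f p)).
Qed.
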